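(* Let $G$ be a finitely generated group, let $\mathcal{A}$ be a family of subgroups of $G$ closed under conjugation and under taking subgroups, and assume that $G$ is finitely presented relative to a finite family of subgroups $\mathcal{H}=\{H_1,\dots,H_p\}$. Then the JSJ deformation space of $G$ over $\mathcal{A}$ relative to $\mathcal{H}$ exists (i.e. there exists a JSJ tree of $G$ over $\mathcal{A}$ relative to $\mathcal{H}$). Moreover, it contains a tree with finitely generated edge stabilizers.
   Context: $G$ is finitely presented relative to $\{H_1,\dots,H_p\}$ if there is a finite subset $\Omega\subset G$ such that the natural morphism $\mathbb{F}(\Omega)*H_1*\dots*H_p\to G$ is onto (where $\mathbb{F}(\Omega)$ is the free group on $\Omega$) and its kernel is normally generated by a finite subset. A tree is a simplicial tree $T$ with an action of $G$ by simplicial automorphisms, without inversions, and minimal (no proper $G$-invariant subtree); the one-point tree is allowed. A subgroup is elliptic in $T$ if it fixes a point. An $(\mathcal{A},\mathcal{H})$-tree is a tree whose edge stabilizers belong to $\mathcal{A}$ and in which every $H\in\mathcal{H}$ is elliptic. An $(\mathcal{A},\mathcal{H})$-tree is universally elliptic if its edge stabilizers are elliptic in every $(\mathcal{A},\mathcal{H})$-tree. $T$ dominates $T'$ if there is a $G$-equivariant map $T\to T'$. A JSJ tree over $\mathcal{A}$ relative to $\mathcal{H}$ is a universally elliptic $(\mathcal{A},\mathcal{H})$-tree which dominates every universally elliptic $(\mathcal{A},\mathcal{H})$-tree. The JSJ deformation space is the set of all JSJ trees, if non-empty. *)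

(* Defs.v *)
From HB Require Import structures.
From mathcomp Require Import all_boot all_classical.

Set Implicit Arguments.
Unset Strict Implicit.
Unset Printing Implicit Defensive.

Local Open Scope classical_set_scope.
Local Open Scope quotient_scope.
Local Open Scope group_scope.

Record subgroup (G : groupType) := Subgroup {
  subgroup_set :> set G;
  subgroupP : group_closed (mem subgroup_set) }.

Identity Coercion fun_of_set : set >-> Funclass.

Definition subgroup_sort (G : groupType) (K : subgroup G) : Type :=
  {x : G | x \in subgroup_set K}.

HB.instance Definition _ (G : groupType) (K : subgroup G) :=
  SubChoice.on (subgroup_sort K).
HB.instance Definition _ (G : groupType) (K : subgroup G) :=
  SubChoice_isSubGroup.Build G _ (subgroup_sort K) (subgroupP K).

Definition gen (G : groupType) (S : set G) : set G :=
  [set x | forall K : subgroup G, S `<=` K -> K x].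

Definition finitely_generated (G : groupType) (K : set G) : Prop :=
  exists2 S : set G, finite_set S & gen S = K.

Definition normal (G : groupType) (N : subgroup G) : Prop :=
  forall x g : G, N x -> N (x ^ g).

Definition normal_closure (G : groupType) (R : set G) : set G :=
  [set x | forall N : subgroup G, normal N -> R `<=` N -> N x].

Definition ker (G K : groupType) (f : G -> K) : set G := [set x | f x = 1].

(* The group <X | R>.  A word is a sequence of letters (x, b), the letter     *)
(* standing for x if b = false and for x^-1 if b = true.                      *)
Section Presentation.
Variables (X : choiceType) (R : set (seq (X * bool))).
Implicit Types u v w : seq (X * bool).

Inductive word_eqv : seq (X * bool) -> seq (X * bool) -> Prop :=
| word_eqv_refl u : word_eqv u u
| word_eqv_sym u v : word_eqv u v -> word_eqv v u
| word_eqv_trans u v w : word_eqv u v -> word_eqv v w -> word_eqv u w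
| word_eqv_cancel u v x b : word_eqv (u ++ [:: (x, b); (x, ~~ b)] ++ v) (u ++ v)
| word_eqv_relator u v r : R r -> word_eqv (u ++ r ++ v) (u ++ v).

Definition word_rel : rel (seq (X * bool)) := fun u v => `[< word_eqv u v >].

Lemma word_rel_refl : reflexive word_rel.
Proof. by move=> u; apply/asboolP/word_eqv_refl. Qed.

Lemma word_rel_sym : symmetric word_rel.
Proof. by move=> u v; apply/asboolP/asboolP => /word_eqv_sym. Qed.

Lemma word_rel_trans : transitive word_rel.
Proof.
by move=> v u w /asboolP uv /asboolP vw; apply/asboolP/(word_eqv_trans uv vw).
Qed.

Canonical word_equiv := EquivRel word_rel word_rel_refl word_rel_sym word_rel_trans.

Definition pres : Type := {eq_quot word_equiv}.

HB.instance Definition _ := Choice.on pres.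
HB.instance Definition _ := Quotient.on pres.

Definition word_class u : pres := \pi u.

Lemma word_class_ind (P : pres -> Prop) :
  (forall u, P (word_class u)) -> forall x, P x.
Proof. by move=> Pu x; rewrite -[x]reprK; apply: Pu. Qed.

Definition word_inv u : seq (X * bool) := rev [seq (l.1, ~~ l.2) | l <- u].

Definition pres_one : pres := word_class [::].
Definition pres_mul (x y : pres) : pres := word_class (repr x ++ repr y).
Definition pres_inv (x : pres) : pres := word_class (word_inv (repr x)).

Lemma pres_eqP u v : word_class u = word_class v <-> word_eqv u v.
Proof.
split=> uv; first by apply/asboolP; have /eqmodP := uv.
by apply/eqmodP/asboolP.
Qed.

Lemma word_eqv_ctx u v s t : word_eqv u v -> word_eqv (s ++ u ++ t) (s ++ v ++ t).
Proof.
elim=> {u v} [u|u v _|u v w _ uv _ vw|u v x b|u v r Rr].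
- exact: word_eqv_refl.
- exact: word_eqv_sym.
- exact: word_eqv_trans uv vw.
- by rewrite -!catA !(catA s u); apply: word_eqv_cancel.
- by rewrite -!catA !(catA s u); apply: word_eqv_relator.
Qed.

Lemma repr_eqv u : word_eqv (repr (word_class u)) u.
Proof. by apply/pres_eqP; rewrite /word_class reprK. Qed.

Lemma pres_mulE u v : pres_mul (word_class u) (word_class v) = word_class (u ++ v).
Proof.
apply/pres_eqP/(@word_eqv_trans _ (u ++ repr (word_class v))).
  exact: (word_eqv_ctx [::] _ (repr_eqv u)).
by have := word_eqv_ctx u [::] (repr_eqv v); rewrite !cats0.
Qed.

Lemma word_inv_r u : word_eqv (u ++ word_inv u) [::].
Proof.
elim/last_ind: u => [|u [x b] IHu]; first exact: word_eqv_refl.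
rewrite /word_inv map_rcons rev_rcons cat_rcons; apply: word_eqv_trans IHu.
exact: (word_eqv_cancel u (word_inv u) x b).
Qed.

Lemma word_invK : involutive word_inv.
Proof.
by move=> u; rewrite /word_inv map_rev revK -map_comp map_id_in // => -[x b] _;
  rewrite /= negbK.
Qed.

Lemma pres_mulA : associative pres_mul.
Proof.
elim/word_class_ind=> u; elim/word_class_ind=> v; elim/word_class_ind=> w.
by rewrite !pres_mulE catA.
Qed.

Lemma pres_mul1 : left_id pres_one pres_mul.
Proof. by elim/word_class_ind=> u; rewrite pres_mulE. Qed.

Lemma pres_1mul : right_id pres_one pres_mul.
Proof. by elim/word_class_ind=> u; rewrite pres_mulE cats0. Qed.

Lemma pres_mulV : right_inverse pres_one pres_inv pres_mul.
Proof.
move=> x; have {1}-> : x = word_class (repr x) by rewrite /word_class reprK.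
by rewrite pres_mulE; apply/pres_eqP/word_inv_r.
Qed.

Lemma pres_Vmul : left_inverse pres_one pres_inv pres_mul.
Proof.
move=> x; have {2}-> : x = word_class (repr x) by rewrite /word_class reprK.
rewrite pres_mulE; apply/pres_eqP.
by have := word_inv_r (word_inv (repr x)); rewrite word_invK.
Qed.

HB.instance Definition _ := isGroup.Build pres
  pres_mulA pres_mul1 pres_1mul pres_Vmul pres_mulV.

Definition pres_gen (x : X) : pres := word_class [:: (x, false)].

Variables (G : groupType) (f : X -> G).

Definition word_eval u : G := \prod_(l <- u) (if l.2 then (f l.1)^-1 else f l.1).

(* The extension of f to <X | R>; it is meaningful if f kills the relators.   *)
Definition pres_lift (x : pres) : G := word_eval (repr x).

Hypothesis fR : forall r, R r -> word_eval r = 1.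

Lemma word_eval_eqv u v : word_eqv u v -> word_eval u = word_eval v.
Proof.
elim=> {u v} [//|u v _ -> //|u v w _ -> _ -> //|u v x b|u v r Rr].
  rewrite /word_eval !big_cat !big_cons big_nil /= mulg1.
  by case: b; rewrite /= ?mulgV ?mulVg mul1g.
by rewrite /word_eval !big_cat /= -[X in _ * (X * _)]/(word_eval r) fR// mul1g.
Qed.

Lemma pres_lift_class u : pres_lift (word_class u) = word_eval u.
Proof. exact/word_eval_eqv/repr_eqv. Qed.

Lemma pres_lift_gen x : pres_lift (pres_gen x) = f x.
Proof. by rewrite pres_lift_class /word_eval big_seq1. Qed.

Lemma pres_liftM : {morph pres_lift : x y / x * y}.
Proof. by move=> x y; rewrite pres_lift_class /word_eval big_cat. Qed.

End Presentation.

Definition freegroup (X : choiceType) : groupType := pres (@set0 (seq (X * bool))).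

Section FreeGroupLift.
Variables (X : choiceType) (G : groupType) (f : X -> G).

Definition freegroup_lift : freegroup X -> G := @pres_lift X set0 G f.

Lemma freegroup_lift_gen x : freegroup_lift (pres_gen set0 x) = f x.
Proof. exact: pres_lift_gen. Qed.

Lemma freegroup_liftM : {morph freegroup_lift : x y / x * y}.
Proof. exact: pres_liftM. Qed.

HB.instance Definition _ := isMultiplicative.Build _ _ freegroup_lift freegroup_liftM.

End FreeGroupLift.

(* The free product of the K i is presented by their multiplication tables:   *)
(* the generators are the elements of all K i and the relators are the words  *)
(* x . y . (x * y)^-1 with x and y in the same factor.                        *)
Section FreeProduct.
Variables (I : choiceType) (K : I -> groupType).

Definition table_relators : set (seq ({i : I & K i} * bool)) :=
  [set r | exists i (x y : K i),
    r = [:: (existT K i x, false); (existT K i y, false);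
            (existT K i (x * y), true)]].

Definition freeprod : groupType := pres table_relators.

Definition freeprod_in (i : I) (x : K i) : freeprod :=
  pres_gen table_relators (existT K i x).

Lemma freeprod_inM i : {morph @freeprod_in i : x y / x * y}.
Proof.
move=> x y; rewrite [RHS]pres_mulE; apply/pres_eqP.
have := word_eqv_cancel table_relators
  [:: (existT K i x, false); (existT K i y, false)] [::] (existT K i (x * y)) true.
rewrite cats0 /= => /word_eqv_sym; move/word_eqv_trans => tr.
apply/word_eqv_sym/tr.
apply: (@word_eqv_relator _ _ [::] [:: (existT K i (x * y), false)]
  [:: (existT K i x, false); (existT K i y, false); (existT K i (x * y), true)]).
by exists i, x, y.
Qed.

HB.instance Definition _ i :=
  isMultiplicative.Build _ _ (@freeprod_in i) (@freeprod_inM i).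

Variables (G : groupType) (f : forall i, {multiplicative K i -> G}).

Definition freeprod_lift : freeprod -> G :=
  @pres_lift _ table_relators G (fun s => f (projT1 s) (projT2 s)).

Lemma table_relators_eval r : table_relators r ->
  word_eval (fun s : {i : I & K i} => f (projT1 s) (projT2 s)) r = 1.
Proof.
move=> [i [x [y ->]]].
by rewrite /word_eval !big_cons big_nil /= mulg1 gmulfM mulgA mulgV.
Qed.

Lemma freeprod_lift_in i x : freeprod_lift (@freeprod_in i x) = f i x.
Proof. exact: (pres_lift_gen table_relators_eval). Qed.

Lemma freeprod_liftM : {morph freeprod_lift : x y / x * y}.
Proof. exact: (pres_liftM table_relators_eval). Qed.

HB.instance Definition _ := isMultiplicative.Build _ _ freeprod_lift freeprod_liftM.

End FreeProduct.

Section RelativePresentation.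
Variables (G : groupType) (Omega : set G) (p : nat) (H : 'I_p -> subgroup G).

Definition rel_factor (o : option 'I_p) : groupType :=
  if o is Some i then subgroup_sort (H i) else freegroup Omega.

Definition rel_factor_map (o : option 'I_p) : {multiplicative rel_factor o -> G} :=
  match o return {multiplicative rel_factor o -> G} with
  | Some i => (val : subgroup_sort (H i) -> G)
  | None => freegroup_lift (val : Omega -> G)
  end.

Definition rel_map : freeprod rel_factor -> G := freeprod_lift rel_factor_map.

End RelativePresentation.

Arguments rel_map {G} Omega {p} H.

Definition rel_finitely_presented (G : groupType) (p : nat)
    (H : 'I_p -> subgroup G) : Prop :=
  exists Omega : set G, [/\ finite_set Omega,
    forall g : G, exists u, rel_map Omega H u = g &
    exists2 R, finite_set R & ker (rel_map Omega H) = normal_closure R].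

(* Subtrees of a tree are determined by their vertices, hence are represented *)
(* by sets of vertices.                                                       *)
Definition connected_in (V : choiceType) (adj : rel V) (S : set V) : Prop :=
  forall x y : V, S x -> S y ->
    exists s : seq V, [/\ path adj x s, last x s = y & forall z, z \in s -> S z].

Record is_tree (V : choiceType) (adj : rel V) : Prop := IsTree {
  tree_nonempty : [set: V] !=set0;
  tree_adj_sym : symmetric adj;
  tree_adj_irr : irreflexive adj;
  tree_connected : connected_in adj setT;
  tree_acyclic : forall c : seq V, ucycle adj c -> (size c <= 2)%N }.

Record gtree (G : groupType) := GTree {
  vertex :> choiceType;
  adj : rel vertex;
  act : G -> vertex -> vertex;
  gtreeP : is_tree adj;
  act1 : forall x, act 1 x = x;
  actM : forall g h x, act (g * h) x = act g (act h x);
  act_adj : forall g x y, adj (act g x) (act g y) = adj x y;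
  no_inversion : forall g x y, adj x y -> ~ (act g x = y /\ act g y = x);
  minimal : forall S : set vertex, S !=set0 -> connected_in adj S ->
    (forall g x, S x -> S (act g x)) -> S = setT }.

Section Trees.
Variable G : groupType.
Implicit Types (T : gtree G) (K : subgroup G) (A : set (subgroup G)).

(* There are no inversions, so the stabilizer of an edge is its pointwise     *)
(* stabilizer.                                                                *)
Definition edge_stab_set T (x y : T) : set G := [set g | act g x = x /\ act g y = y].

Lemma edge_stab_subproof T (x y : T) : group_closed (mem (edge_stab_set x y)).
Proof.
have fixV (z : T) h : act h z = z -> act h^-1 z = z.
  by move=> hz; rewrite -{1}hz -actM mulVg act1.
split; first by apply/mem_set; split; exact: act1.
move=> g h /set_mem[gx gy] /set_mem[hx hy]; apply/mem_set.
by split; rewrite actM fixV.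
Qed.

Definition edge_stab T (x y : T) : subgroup G := Subgroup (edge_stab_subproof x y).

(* There are no inversions, so a subgroup fixing a point of the geometric     *)
(* realization fixes a vertex.                                                *)
Definition elliptic T K : Prop := exists x : T, forall g : G, K g -> act g x = x.

(* Maps between trees send vertices to vertices and are linear on edges, so   *)
(* they are determined by their values on vertices; any equivariant map on    *)
(* vertices extends.                                                          *)
Definition dominates T T' : Prop :=
  exists f : T -> T', forall g x, f (act g x) = act g (f x).

Definition conj_closed A : Prop :=
  forall (K L : subgroup G) (g : G), A K -> L = [set x ^ g | x in K] :> set G -> A L.

Definition sub_closed A : Prop :=
  forall K L : subgroup G, A K -> L `<=` K -> A L.

Variables (A : set (subgroup G)) (p : nat) (H : 'I_p -> subgroup G).

Definition AH_tree T : Prop :=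
  (forall x y : T, adj x y -> A (edge_stab x y)) /\ (forall i, elliptic T (H i)).

Definition universally_elliptic T : Prop :=
  AH_tree T /\
  forall T', AH_tree T' -> forall x y : T, adj x y -> elliptic T' (edge_stab x y).

Definition JSJ_tree T : Prop :=
  universally_elliptic T /\ forall T', universally_elliptic T' -> dominates T T'.

Definition JSJ_deformation_space : gtree G -> Prop := JSJ_tree.

End Trees.

(* Main.v *)
(* A G-tree T together with an equivariant map to T from the vertices of a
   complex X, connected and without cohomology in degree one modulo 2, has a
   resolution S: the dual tree of the tracks, i.e. of the components of the
   preimages in X of the midpoints of the edges of T.  Its edge stabilizers fix
   edges of T, and they are finitely generated when G acts on X cofinitely with
   trivial edge stabilizers.  A relative finite presentation provides such an X,
   whose vertices are the elements of G and the cosets of the H_i.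

   Accessibility is replaced by linear algebra.  The invariant length functions on
   T, pulled back to the finitely many G-orbits of edges of X, span a subspace of
   a fixed finite-dimensional space.  Choose T, among the universally elliptic
   trees, such that this subspace has maximal dimension.  If T' is another
   universally elliptic tree, let W be the blow-up of S in which every vertex is
   replaced by a copy of T'; it is universally elliptic and its length functions
   include those of S, so by maximality the distance of W is on the edges of X a
   length function D of S.  Adding a multiple of the distance of S on both sides
   makes D nonnegative and the length on W positive.  As S is determined by the
   tripods in the triangles of X, sending a vertex of S to the point of W at the
   same length along the image of an edge of X is then well defined.  Hence the
   vertex stabilizers of S are elliptic in W, and so in T', which means that S
   dominates T'.  A minimal invariant subtree of S is the required JSJ tree. *)

Require Import Defs.
From HB Require Import structures.
From mathcomp Require Import all_boot all_order all_algebra all_classical.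
From mathcomp Require Import zify lra.

Set Implicit Arguments.
Unset Strict Implicit.
Unset Printing Implicit Defensive.

Local Open Scope classical_set_scope.
Local Open Scope group_scope.

(** * Distances in trees *)

Section Walks.
Variables (V : choiceType) (adj : rel V).

Definition walk x y := exists s, path adj x s /\ last x s = y.

Lemma walk_refl x : walk x x.
Proof. by exists [::]. Qed.

Lemma walk_trans x y z : walk x y -> walk y z -> walk x z.
Proof.
move=> [s [ps sy]] [t [pt tz]]; exists (s ++ t).
by rewrite cat_path last_cat ps sy.
Qed.

Lemma walk_adj x y : adj x y -> walk x y.
Proof. by move=> xy; exists [:: y]; rewrite /= xy. Qed.

Lemma walk_sym x y : symmetric adj -> walk x y -> walk y x.
Proof.
move=> adjC [s [+ <-]]; elim: s x => [|z s IH] x /=; first by move=> _; apply: walk_refl.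
move=> /andP[xz /IH] zs; apply: walk_trans zs _; apply: walk_adj.
by rewrite adjC.
Qed.

Lemma connected_of_walks (S : set V) :
  (forall x y, S x -> S y -> walk x y) -> S = setT -> connected_in adj S.
Proof.
by move=> W ST x y Sx Sy; have [s [ps sy]] := W x y Sx Sy; exists s; rewrite ST.
Qed.

(* A witness that the edge [uv] is a bridge. *)
Definition cut u v (s : V -> bool) := s u <> s v /\
  forall a b, adj a b -> s a <> s b -> (a = u /\ b = v) \/ (a = v /\ b = u).

(** A cycle with at least three vertices that starts with the edge [xy] returns from [y] to [x]
    without using this edge again, so a cut of [xy] would take equal values at its two ends. *)
Lemma is_tree_of_cuts : [set: V] !=set0 -> symmetric adj -> irreflexive adj ->
  (forall x y, walk x y) -> (forall u v, adj u v -> exists s, cut u v s) ->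
  is_tree adj.
Proof.
move=> V0 adjC adjI W cuts; split=> //; first exact: connected_of_walks.
case=> [//|x [//|y [//|z q]]] /andP[cyc uq]; exfalso.
move: cyc; rewrite /= rcons_path => /and3P[xy yz /andP[pq lx]].
have {yz pq} pq : path adj y (z :: q) by rewrite /= yz.
have {}lx : adj (last y (z :: q)) x by [].
have [s [sxy cs]] := cuts _ _ xy.
move: uq; rewrite cons_uniq [uniq _]cons_uniq => /andP[xyzq /andP[yzq _]].
have xzq : x \notin z :: q by move: xyzq; rewrite inE negb_or => /andP[].
have yx : y != x by apply/eqP => e; move: xyzq; rewrite e inE eqxx.
have slast r a : a != x -> x \notin r -> path adj a r -> s (last a r) = s a.
  elim: r a => [//|b r IH] a ax; rewrite inE negb_or => /andP[xb xr] /=.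
  move=> /andP[ab /IH] ->; rewrite 1?eq_sym//; apply/eqP/negPn/negP => /eqP sab.
  by case: (cs _ _ ab (nesym sab)) => -[] e1 e2; subst; rewrite eqxx in ax xb.
have sl : s (last y (z :: q)) <> s x by rewrite slast// => /esym.
case: (cs _ _ lx sl) => -[e1 e2]; first by rewrite e2 eqxx in yx.
by move: yzq; rewrite -e1 /= mem_last.
Qed.

End Walks.

Section Distance.
Variables (V : choiceType) (adj : rel V) (treeP : is_tree adj).

Let adjC : symmetric adj := tree_adj_sym treeP.
Let adjI : irreflexive adj := tree_adj_irr treeP.

Lemma dist_subproof x y :
  exists n, `[< exists s, [/\ path adj x s, last x s = y & size s = n] >].
Proof.
have [s [ps sy _]] := @tree_connected _ _ treeP x y I I.
by exists (size s); apply/asboolP; exists s.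
Qed.

Definition dist x y := ex_minn (dist_subproof x y).

Lemma distP x y : exists s, [/\ path adj x s, last x s = y & size s = dist x y].
Proof. by rewrite /dist; case: ex_minnP => n /asboolP. Qed.

Lemma dist_le x y s : path adj x s -> last x s = y -> (dist x y <= size s)%N.
Proof.
by move=> ps sy; rewrite /dist; case: ex_minnP => n _; apply; apply/asboolP; exists s.
Qed.

Lemma dist0 x : dist x x = 0%N.
Proof. by apply/eqP; rewrite -leqn0; apply: (@dist_le x x [::]). Qed.

Lemma dist_eq0 x y : dist x y = 0%N -> x = y.
Proof. by have [s [_ <- <-]] := distP x y => /size0nil ->. Qed.

Lemma dist_triangle y x z : (dist x z <= dist x y + dist y z)%N.
Proof.
have [s [ps sy <-]] := distP x y; have [t [pt tz <-]] := distP y z.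
by rewrite -size_cat; apply: dist_le; rewrite ?cat_path ?last_cat ?ps sy.
Qed.

Lemma adj_dist x y : adj x y -> dist x y = 1%N.
Proof.
move=> xy; have le1 : (dist x y <= 1)%N by apply: (@dist_le x y [:: y]); rewrite /= ?xy.
case e : (dist x y) le1 => [|[|n]] // _.
by move: xy; rewrite (dist_eq0 e) adjI.
Qed.

Lemma dist_pred x y n : dist x y = n.+1 -> exists2 z, adj z y & dist x z = n.
Proof.
have [s [+ + e]] := distP x y => + + d; rewrite d in e.
case/lastP: s e => [//|s z]; rewrite rcons_path last_rcons size_rcons.
move=> [sn] /andP[ps lz] ezy; subst z; exists (last x s) => //.
have := dist_le ps erefl; rewrite sn.
by have := dist_triangle (last x s) x y; rewrite (adj_dist lz) d; lia.
Qed.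

Lemma dist_sym x y : dist x y = dist y x.
Proof.
suff le a b : (dist a b <= dist b a)%N by apply/eqP; rewrite eqn_leq !le.
case e : (dist b a) => [|n]; first by rewrite (dist_eq0 e) dist0.
elim: n a e => [|n IH] a e; have [z za bz] := dist_pred e.
  by rewrite (dist_eq0 bz) in za *; rewrite adj_dist// adjC.
have := dist_triangle z a b; have := IH _ bz; rewrite (@adj_dist a z) 1?adjC//.
by lia.
Qed.

(** Along a geodesic from [y] to [r] the distance to [r] drops at each step, hence stays below that
    of [x] after [y]. *)
Lemma path_to_avoiding x y r : (dist y r <= dist x r)%N -> y != x ->
  exists s, [/\ path adj y s, last y s = r & x \notin y :: s].
Proof.
move e : (dist y r) => n; elim: n y e => [|n IH] y e le yx.
  by exists [::]; rewrite (dist_eq0 e) inE eq_sym -(dist_eq0 e) yx.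
rewrite dist_sym in e; have [z zy rz] := dist_pred e; rewrite dist_sym in rz.
have zx : z != x by apply/eqP => zx; move: le; rewrite -zx rz ltnn.
have [s [ps sz xs]] := IH z rz (ltnW le) zx.
by exists (z :: s); split; rewrite //= ?(adjC y) ?zy// inE negb_or eq_sym yx.
Qed.

Lemma path_from_avoiding x y r : (dist y r <= dist x r)%N -> y != x ->
  exists s, [/\ path adj r s, last r s = y & x \notin r :: s].
Proof.
move=> le yx; have [s [ps sr xs]] := path_to_avoiding le yx.
exists (rev (belast y s)); split.
- have := rev_path adj y s; rewrite sr => ->.
  by rewrite (eq_path (e' := adj))// => a b; rewrite adjC.
- by case: s sr {ps xs} => [|a s] //= _; rewrite rev_cons last_rcons.
- move: xs; rewrite lastI sr -rev_rcons mem_rev; done.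
Qed.

(* Otherwise the paths from the two neighbours to [r] would close up to a cycle
   through [x]. *)
Lemma neighbor_toward_uniq r x y z : adj x y -> adj x z ->
  (dist y r <= dist x r)%N -> (dist z r <= dist x r)%N -> y = z.
Proof.
move=> xy xz yr zr; apply/eqP/negPn/negP => yz.
have nx a : adj x a -> a != x by move=> xa; apply/eqP => e; rewrite e adjI in xa.
have [s [ps sr xs]] := path_to_avoiding yr (nx _ xy).
have [t [pt tz xt]] := path_from_avoiding zr (nx _ xz).
have pst : path adj y (s ++ t) by rewrite cat_path ps sr.
have lst : last y (s ++ t) = z by rewrite last_cat sr.
have xst : x \notin y :: s ++ t.
  by move: xs xt; rewrite !inE mem_cat !negb_or => /andP[-> ->] /andP[_ ->].
case/shortenP: pst lst => q pq uq qst lq.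
have xq : x \notin y :: q.
  move: xst; apply: contra; rewrite !inE => /orP[->//|/qst ->]; by rewrite orbT.
have := @tree_acyclic _ _ treeP (x :: y :: q); rewrite /ucycle.
case: q pq uq qst lq xq => [|a q] pq uq _ lq xq.
  by move: yz; rewrite -lq /= eqxx.
have cyc : ucycleb adj (x :: y :: a :: q).
  rewrite /ucycleb [uniq _]cons_uniq xq uq andbT /= rcons_path xy.
  have lx : adj (last y (a :: q)) x by rewrite lq adjC.
  by move: pq lx => /= /andP[-> ->] ->.
by move/(_ cyc).
Qed.

(** If [y] is no farther from [r] than [x], then by uniqueness it is the neighbour of [x] that lies
    one step closer to [r]. *)
Lemma adj_dist_cases r x y : adj x y ->
  dist y r = (dist x r).+1 \/ dist x r = (dist y r).+1.
Proof.
wlog le : x y / (dist y r <= dist x r)%N => [W xy|xy].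
  case/orP: (leq_total (dist y r) (dist x r)) => le; first exact: W.
  by rewrite adjC in xy; case: (W _ _ le xy); [right|left].
right; case e : (dist x r) => [|n].
  by move: le xy; rewrite e leqn0 => /eqP/dist_eq0 ->; rewrite (dist_eq0 e) adjI.
rewrite dist_sym in e; have [z zx rz] := dist_pred e.
rewrite ![dist r _]dist_sym in e rz.
have xz : adj x z by rewrite adjC.
have -> : y = z by apply: (@neighbor_toward_uniq r x) => //; lia.
by rewrite rz.
Qed.

Definition btw x z y := (dist x z + dist z y = dist x y)%N.

Lemma btw_sym x z y : btw x z y -> btw y z x.
Proof. by rewrite /btw !(dist_sym y) [dist z x]dist_sym addnC. Qed.

Lemma btw_left x y : btw x x y.
Proof. by rewrite /btw dist0. Qed.

Lemma btw_right x y : btw x y y.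
Proof. by rewrite /btw dist0 addn0. Qed.

Lemma btw_ex x y i : (i <= dist x y)%N -> exists2 z, btw x z y & dist x z = i.
Proof.
move e : (dist x y - i)%N => k; elim: k i e => [|k IH] i e le.
  by exists y; [exact: btw_right|apply/eqP; rewrite eqn_leq -subn_eq0 e].
have [z bz xz] : exists2 z, btw x z y & dist x z = i.+1 by apply: IH; lia.
have [w wz xw] := dist_pred xz; exists w => //.
move: bz; rewrite /btw => bz; have := dist_triangle z w y.
by rewrite (adj_dist wz); have := dist_triangle w x y; lia.
Qed.

(** By induction from [y] backwards: the successors of [z] and [w] toward [y] agree, and [z] and [w]
    are then both the neighbour of this vertex toward [x]. *)
Lemma btw_uniq x y z w : btw x z y -> btw x w y -> dist x z = dist x w -> z = w.
Proof.
move e : (dist z y) => k; elim: k z w e => [|k IH] z w e bz bw d.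
  by rewrite (dist_eq0 e) in bz d *; rewrite (@dist_eq0 w y)//; move: bw; rewrite /btw; lia.
have ew : dist w y = k.+1 by move: bz bw; rewrite /btw; lia.
rewrite dist_sym in e; have [z' zz' yz'] := dist_pred e.
rewrite dist_sym in ew; have [w' ww' yw'] := dist_pred ew.
have step a a' : adj a' a -> dist y a = k.+1 -> dist y a' = k -> btw x a y ->
    btw x a' y /\ dist x a' = (dist x a).+1.
  move=> aa' ya ya'; rewrite /btw ![dist _ y]dist_sym.
  have := dist_triangle a x a'; rewrite (@adj_dist a a') 1?adjC// => h1 h2.
  by have := dist_triangle a' x y; rewrite ![dist _ y]dist_sym; lia.
have [bz' dz'] := step _ _ zz' e yz' bz; have [bw' dw'] := step _ _ ww' ew yw' bw.
have e' : z' = w' by apply: IH => //; [rewrite dist_sym|lia].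
rewrite -e' in ww' dw'.
by apply: (@neighbor_toward_uniq x z') => //; rewrite !(dist_sym _ x); lia.
Qed.

(* In other words, a path without backtracking is a geodesic. *)
Lemma btw_or_neighbor x m y : btw x m y \/
  exists z, [/\ adj m z, dist m x = (dist z x).+1 & dist m y = (dist z y).+1].
Proof.
move e : (dist m y) => k; elim: k m e => [|k IH] m e.
  by left; rewrite (dist_eq0 e); exact: btw_right.
rewrite dist_sym in e; have [z zm yz] := dist_pred e; rewrite dist_sym in yz.
have mz : adj m z by rewrite adjC.
rewrite dist_sym in e.
case: (adj_dist_cases x mz) => d; last by right; exists z; rewrite yz.
case: (IH z yz) => [b|[w [zw wx wy]]].
  by left; move: b e d; rewrite /btw (dist_sym x z) (dist_sym x m) yz; lia.
have ew : w = m by apply: (@neighbor_toward_uniq x z) => //; lia.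
by move: wy; rewrite ew; lia.
Qed.

Lemma btw_trans x z m y : btw x m y -> btw x z m -> btw x z y.
Proof.
rewrite /btw => b1 b2; have := dist_triangle z x y; have := dist_triangle m z y; lia.
Qed.

Lemma btw_restrict x z m y : btw x m y -> btw x z y ->
  (dist x z <= dist x m)%N -> btw x z m.
Proof.
move=> bm bz /btw_ex[w bw xw].
by rewrite (btw_uniq bz (btw_trans bm bw)).
Qed.

(** Start with [m = x] and advance as long as some neighbour of [m] is closer to both [y] and
    [z]. *)
Lemma median x y z : exists m, [/\ btw x m y, btw x m z & btw y m z].
Proof.
suff : forall k m, dist m y = k -> btw x m y -> btw x m z ->
    exists m, [/\ btw x m y, btw x m z & btw y m z].
  by apply; [reflexivity|exact: btw_left|exact: btw_left].
elim=> [|k IH] m e bxy bxz.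
  exists m; split=> //; rewrite (dist_eq0 e); exact: btw_left.
case: (btw_or_neighbor y m z) => [|[w [mw wy wz]]]; first by exists m.
have d := adj_dist mw; have := dist_triangle m x w; rewrite d => xw.
apply: (IH w); first by lia.
  by move: bxy; rewrite /btw; have := dist_triangle w x y; lia.
by move: bxz; rewrite /btw; have := dist_triangle w x z; lia.
Qed.

Lemma cut_crossed u v s x y : cut adj u v s -> s x <> s y ->
  exists p q, [/\ adj p q, btw x p y, btw x q y, dist x q = (dist x p).+1 &
    s p = s x /\ s q = s y].
Proof.
move=> cs; move e : (dist y x) => k; elim: k y e => [|k IH] y e sxy.
  by move: sxy; rewrite (dist_eq0 e).
rewrite dist_sym in e; have [z zy xz] := dist_pred e.
have bz : btw x z y by rewrite /btw xz (adj_dist zy) e addn1.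
case: (eqVneq (s z) (s x)) => sz.
  exists z, y; split=> //; first exact: btw_right.
  by rewrite xz.
have szy : s z = s y by case: (s z) (s x) (s y) sz sxy => [] [] [].
rewrite dist_sym in xz; have := IH z xz; rewrite szy => /(_ sxy)[p [q [pq bp bq d sp]]].
by exists p, q; split=> //; apply: btw_trans bz _.
Qed.

(** Otherwise the geodesic crosses the edge [uv] once before and once after [z]; it meets the same
    end [p] of this edge on both sides of [z], which forces [p = z]. *)
Lemma cut_convex u v s x z y : cut adj u v s -> btw x z y -> s x = s y -> s z = s x.
Proof.
move=> cs bz sxy; apply/eqP/negPn/negP => /eqP sz.
have [p [q [pq bp bq d [sp sq]]]] := cut_crossed cs (nesym sz).
have szy : s z <> s y by rewrite -sxy.
have [p' [q' [pq' bp' bq' d' [sp' sq']]]] := cut_crossed cs szy.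
have e : p = q'.
  case: cs => suv cs.
  have spq : s p <> s q by rewrite sp sq => h; apply: sz.
  have spq' : s p' <> s q' by rewrite sp' sq'.
  by case: (cs _ _ pq spq) => -[e1 e2]; case: (cs _ _ pq' spq') => -[e3 e4]; subst => //;
    exfalso; apply: suv; congruence.
subst q'; move: bz bp bq'; rewrite /btw => bz bp bq'.
have := dist_triangle p x y; have e0 : dist p z = 0%N.
  by have := dist_triangle p x y; rewrite [dist z p]dist_sym in bq'; lia.
by move=> _; apply: sz; rewrite -sp (dist_eq0 e0).
Qed.

Definition side u v x := (dist x v < dist x u)%N.

(** Let [ab] be an edge with [a] on the side of [v] and [b] on the side of [u]. Then [a] is as far
    from [v] as [b] from [u]. If this distance were positive, the neighbour of [a] toward [v] and
    the vertex [b] would both be the neighbour of [a] toward [u]. *)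
Lemma side_cut u v : adj u v -> cut adj u v (side u v).
Proof.
move=> uv; split; first by rewrite /side !dist0 (adj_dist uv) dist_sym (adj_dist uv).
have main a b : adj a b -> side u v a -> ~~ side u v b -> a = v /\ b = u.
  rewrite /side => ab av bv.
  have ba : adj b a by rewrite adjC. 
  have vu : adj v u by rewrite adjC. 
  have h1 := adj_dist_cases a uv; have h2 := adj_dist_cases b uv.
  have h3 := adj_dist_cases u ab; have h4 := adj_dist_cases v ab.
  rewrite ![dist u _]dist_sym ![dist v _]dist_sym in h1 h2.
  have e : dist a v = dist b u by lia.
  case k : (dist a v) => [|n]; first by rewrite (dist_eq0 k) (@dist_eq0 b u) -?e.
  have [a' aa' va'] : exists2 a', adj a' a & dist v a' = n.
    by apply: dist_pred; rewrite dist_sym.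
  rewrite dist_sym in va'; have aa : adj a a' by rewrite adjC.
  have a'u := dist_triangle v a' u; rewrite (adj_dist vu) in a'u.
  have : a' = b by apply: (@neighbor_toward_uniq u a) => //; lia.
  by move=> e'; move: va'; rewrite e'; lia.
move=> a b ab; case sa : (side u v a); case sb : (side u v b) => // _.
  by right; apply: main => //; rewrite sb.
by left; have [] := main b a; rewrite 1?adjC ?sb ?sa.
Qed.

End Distance.

(** * Trees with a group action and their length functions *)

(** Makes the representative of an orbit independent of the point that serves as default. *)
Lemma xget_default (T : choiceType) (x y : T) (A : set T) :
  A !=set0 -> xget x A = xget y A.
Proof.
move=> [z Az]; have ex : exists x, `[< A x >] by exists z; apply/asboolP.
rewrite /xget; by case: pselect => // p; case: pselect.
Qed.

(** A [gtree] without minimality, which resolutions and blow-ups may lack; [minimal_gtree] restores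
    it at the end. *)
Record atree (G : groupType) := ATree {
  avertex :> choiceType;
  aadj : rel avertex;
  aact : G -> avertex -> avertex;
  atreeP : is_tree aadj;
  aact1 : forall x, aact 1 x = x;
  aactM : forall g h x, aact (g * h) x = aact g (aact h x);
  aact_adj : forall g x y, aadj (aact g x) (aact g y) = aadj x y;
  ano_inversion : forall g x y, aadj x y -> ~ (aact g x = y /\ aact g y = x) }.

Definition atree_of_gtree (G : groupType) (T : gtree G) : atree G :=
  ATree (gtreeP T) (@act1 _ T) (@actM _ T) (@act_adj _ T) (@no_inversion _ T).

(** On a representative of each orbit, choose a point fixed by its stabilizer, then spread this
    choice over the orbit. The invariant predicate [P] restricts the map to part of [U], such as the
    edges among all pairs of vertices. *)
Lemma equivariant_choice (G : groupType) (U V : choiceType)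
    (aU : G -> U -> U) (aV : G -> V -> V) (P : U -> Prop) (v0 : V) :
  (forall u, aU 1 u = u) -> (forall g h u, aU (g * h) u = aU g (aU h u)) ->
  (forall v, aV 1 v = v) -> (forall g h v, aV (g * h) v = aV g (aV h v)) ->
  (forall g u, P u -> P (aU g u)) ->
  (forall u, P u -> exists v, forall g, aU g u = u -> aV g v = v) ->
  exists f : U -> V, forall g u, P u -> f (aU g u) = aV g (f u).
Proof.
move=> aU1 aUM aV1 aVM PaU fixV.
pose orb u := [set w | exists g, w = aU g u].
pose r u := xget u (orb u).
have orbu u : orb u u by exists 1; rewrite aU1.
have rP u : orb u (r u) by apply: (@xgetPex _ u (orb u)); exists u.
have orbE g u : orb (aU g u) = orb u.
  rewrite predeqE => w; split=> -[h ->].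
    by exists (h * g); rewrite aUM.
  by exists (h * g^-1); rewrite -aUM mulgVK.
have rE g u : r (aU g u) = r u.
  by rewrite /r orbE; apply: xget_default; exists u.
pose h u := xget 1 [set g | u = aU g (r u)].
have hP u : u = aU (h u) (r u).
  apply: (@xgetPex _ 1 [set g | u = aU g (r u)]).
  by have [g ->] := rP u; exists g^-1; rewrite /= -aUM mulVg aU1.
pose v w := xget v0 [set v | forall g, aU g w = w -> aV g v = v].
have vP w : P w -> forall g, aU g w = w -> aV g (v w) = v w.
  move=> /fixV; exact: (@xgetPex _ v0 [set v | forall g, aU g w = w -> aV g v = v]).
exists (fun u => aV (h u) (v (r u))) => g u Pu.
have Pr : P (r u) by have [k ->] := rP u; apply: PaU.
(* Both [a] and [b] carry [r u] to [aU g u], so [b^-1 * a] stabilizes [r u] and fixes the point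
   chosen for it. *)
rewrite rE -aVM; set a := h (aU g u); set b := g * h u.
have -> : a = b * (b^-1 * a) by rewrite mulgA mulgV mul1g.
rewrite aVM (vP _ Pr)//.
have e : aU a (r u) = aU b (r u) by have := hP (aU g u); rewrite rE -/a aUM -hP.
by rewrite aUM e -aUM mulVg aU1.
Qed.

Section ActedTree.
Variables (G : groupType) (T : atree G).
Implicit Types (a b c x y z : T) (g : G).

Notation len := (dist (atreeP T)).
Notation between := (btw (atreeP T)).

Lemma aactK g : cancel (aact g) (aact g^-1 : T -> T).
Proof. by move=> x; rewrite -aactM mulVg aact1. Qed.

Lemma aactKV g : cancel (aact g^-1) (aact g : T -> T).
Proof. by move=> x; rewrite -aactM mulgV aact1. Qed.

Lemma dist_act g x y : len (aact g x) (aact g y) = len x y.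
Proof.
have le h a b : (len (aact h a) (aact h b) <= len a b)%N.
  have [s [ps sb <-]] := distP (atreeP T) a b.
  rewrite -(size_map (aact h) s); apply: dist_le; last by rewrite last_map sb.
  by rewrite path_map (eq_path (e' := @aadj _ T))// => u v; rewrite /= aact_adj.
apply/eqP; rewrite eqn_leq le/=.
by rewrite -{1}[x](aactK g) -{1}[y](aactK g).
Qed.

Lemma btw_act g x z y : between (aact g x) (aact g z) (aact g y) <-> between x z y.
Proof. by rewrite /btw !dist_act. Qed.

Lemma fix_close_pair g x y : x = y \/ aadj x y ->
  (aact g x = x \/ aact g x = y) -> (aact g y = x \/ aact g y = y) -> aact g x = x.
Proof.
move=> xy [//|gx] [gy|gy].
  by case: xy => [xy|/(@ano_inversion _ _ g)[]//]; rewrite -{2}gy xy.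
have xy' : x = y by rewrite -(aactK g x) gx -{1}gy aactK.
by rewrite {1}xy' gy.
Qed.

(** An invariant length of the edges, extended to all segments. Negative values are allowed, so that
    these functions form a vector space over the rationals. *)
Record additive (D : T -> T -> rat) : Prop := Additive {
  additive_act : forall g x y, D (aact g x) (aact g y) = D x y;
  additive_sym : forall x y, D x y = D y x;
  additive_btw : forall x z y, between x z y -> D x y = (D x z + D z y)%R }.

Lemma additive_dist : additive (fun x y => (len x y)%:R%R).
Proof.
split=> [g x y|x y|x z y]; first by rewrite dist_act.
  by rewrite dist_sym.
by rewrite /btw => <-; rewrite GRing.natrD.
Qed.

Lemma additive_comb (m : rat) D D' : additive D -> additive D' ->
  additive (fun x y => D x y + m * D' x y)%R.
Proof.
move=> aD aD'; split=> [g x y|x y|x z y b].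
- by rewrite !additive_act.
- by rewrite (additive_sym aD) (additive_sym aD').
- by rewrite (additive_btw aD b) (additive_btw aD' b); lra.
Qed.

Section Additive.
Variables (D : T -> T -> rat) (aD : additive D).

Lemma additivexx x : D x x = 0%R.
Proof. by have := additive_btw aD (btw_left (atreeP T) x x); lra. Qed.

Lemma additive_ge (M : rat) : (forall x y, aadj x y -> (- M <= D x y)%R) ->
  forall x y, (0 <= D x y + M * (len x y)%:R)%R.
Proof.
move=> DM x y; move e : (len x y) => k; elim: k y e => [|k IH] y e.
  by rewrite (dist_eq0 e) additivexx; lra.
have [z zy xz] := dist_pred e.
have b : between x z y by rewrite /btw xz (adj_dist _ zy) e addn1.
rewrite (additive_btw aD b) -addn1 GRing.natrD.
by have := IH _ xz; have := DM _ _ zy; lra.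
Qed.

Hypothesis D_ge0 : forall x y, (0 <= D x y)%R.

Lemma additive_triangle x y z : (D x z <= D x y + D y z)%R.
Proof.
have [m [b1 b2 b3]] := median (atreeP T) x y z.
rewrite (additive_btw aD b1) (additive_btw aD b2) (additive_btw aD b3).
by rewrite (additive_sym aD y m); have := D_ge0 m y; lra.
Qed.

End Additive.

(** * Length functions defined by weights on the edges *)

Section EdgeSum.
Variables (w : T -> T -> rat).
Hypothesis w_act : forall g x y, w (aact g x) (aact g y) = w x y.
Hypothesis w_sym : forall x y, w x y = w y x.

(** The [i]-th vertex of the segment from [x] to [y]; the default [x] is taken only for [i] beyond
    its end. *)
Definition point x y i := xget x [set z | between x z y /\ len x z = i].

Lemma pointP x y i : (i <= len x y)%N -> between x (point x y i) y /\ len x (point x y i) = i.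
Proof.
by move=> /btw_ex[z bz xz]; apply: (@xgetPex _ x [set z | between x z y /\ len x z = i]); exists z.
Qed.

Lemma point_eq x y z i : between x z y -> len x z = i -> point x y i = z.
Proof.
move=> bz xz; have le : (i <= len x y)%N by move: bz; rewrite /btw; lia.
have [bp xp] := pointP le; apply: (btw_uniq bp bz); by rewrite xp xz.
Qed.

Definition edge_sum x y : rat :=
  (\sum_(0 <= i < len x y) w (point x y i) (point x y i.+1))%R.

Lemma edge_sum_adj x y : aadj x y -> edge_sum x y = w x y.
Proof.
move=> xy; rewrite /edge_sum (adj_dist _ xy) big_nat1.
rewrite (@point_eq x y x 0); [|exact: btw_left|exact: dist0].
by rewrite (@point_eq x y y 1)//; [exact: btw_right|exact: adj_dist].
Qed.

Lemma additive_edge_sum : additive edge_sum.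
Proof.
split=> [g x y|x y|x z y b].
- rewrite /edge_sum dist_act; apply: eq_big_nat => i /andP[_ id].
  have pg j : (j <= len x y)%N -> point (aact g x) (aact g y) j = aact g (point x y j).
    by move=> /pointP[bj dj]; apply: point_eq; rewrite ?dist_act//; apply/btw_act.
  by rewrite !pg// ltnW.
- rewrite /edge_sum (dist_sym _ y x) big_nat_rev/=; apply: eq_big_nat => i /andP[_ id].
  have pr j : (j <= len x y)%N -> point x y (len x y - j) = point y x j.
    move=> le; have [bj dj] : between y (point y x j) x /\ len y (point y x j) = j.
      by apply: pointP; rewrite dist_sym.
    apply: point_eq; first exact: btw_sym.
    by move: bj; rewrite /btw dj (dist_sym _ _ x) (dist_sym _ y x); lia.
  by rewrite add0n subnSK// !pr// 1?ltnW// w_sym.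
- rewrite /edge_sum -[in RHS](add0n (len z y)) -b.
  rewrite (@big_cat_nat _ _ _ (len x z))//= ?leq_addr//; congr (_ + _)%R.
    apply: eq_big_nat => i /andP[_ id].
    have pe j : (j <= len x z)%N -> point x y j = point x z j.
      by move=> /pointP[bj dj]; apply: point_eq => //; apply: btw_trans b _.
    by rewrite !pe// ltnW.
  rewrite -{1}(add0n (len x z)) big_addn addnC addnK add0n.
  apply: eq_big_nat => i /andP[_ id].
  have pe j : (j <= len z y)%N -> point x y (j + len x z) = point z y j.
    move=> /pointP[bj dj]; apply: point_eq.
      apply: btw_sym; apply: btw_trans (btw_sym b) _; exact: btw_sym.
    have := dist_triangle (atreeP T) (point z y j) x y.
    have := dist_triangle (atreeP T) z x (point z y j).
    by move: b bj; rewrite /btw; lia.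
  by rewrite -addSn !pe// ltnW.
Qed.

End EdgeSum.

End ActedTree.

(** * The resolution of a tree *)

(* The 1-skeleton of a simplicial G-complex, all of whose triangles are filled;
   [cE_coboundary] is the vanishing of the first cohomology with coefficients in
   Z/2. *)
Record gcomplex (G : groupType) := GComplex {
  cvertex :> choiceType;
  cact : G -> cvertex -> cvertex;
  cE : cvertex -> cvertex -> Prop;
  cbase : cvertex;
  cact1 : forall x, cact 1 x = x;
  cactM : forall g h x, cact (g * h) x = cact g (cact h x);
  cE_refl : forall x, cE x x;
  cE_sym : forall x y, cE x y -> cE y x;
  cE_act : forall g x y, cE x y -> cE (cact g x) (cact g y);
  cE_connected : forall P : cvertex -> Prop,
    (forall x y, cE x y -> P x -> P y) -> forall x y, P x -> P y;
  cE_coboundary : forall d : cvertex -> cvertex -> bool,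
    (forall x y z, cE x y -> cE y z -> cE x z -> d x z = d x y (+) d y z) ->
    exists s : cvertex -> bool, forall x y, cE x y -> d x y = s x (+) s y;
  cE_cofinite : exists m (u v : 'I_m -> cvertex), (forall k, cE (u k) (v k)) /\
    forall x y, cE x y -> exists k g, x = cact g (u k) /\ y = cact g (v k);
  cE_free : forall g x y, cE x y -> x <> y -> cact g x = x -> cact g y = y -> g = 1;
  cE_finite_link : forall x y, cE x y -> x <> y -> finite_set [set z | cE x z /\ cE y z] }.

(** * Chains of edges across the triangles of a complex *)

Section Chain.
Variables (G : groupType) (X : gcomplex G).
Implicit Types (a b x y z : X) (Q : X -> X -> Prop).

(** [Q] selects the oriented edges that meet a given subset of the complex. A slide passes from the
    side [xy] of the triangle [xyz] to the side [xz], so chains describe the connected components of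
    this subset. *)
Inductive chain Q a b : X -> X -> Prop :=
| chain_refl : chain Q a b a b
| chain_flip x y : chain Q a b x y -> chain Q a b y x
| chain_slide x y z : chain Q a b x y -> Q x y -> Q x z -> cE y z -> chain Q a b x z.

Lemma chain_trans Q x y a b c d : chain Q a b x y -> chain Q x y c d -> chain Q a b c d.
Proof.
move=> ab; elim=> {c d} [//|c d _ IH|c d e _ IH]; first exact: chain_flip.
exact: chain_slide.
Qed.

Lemma chain_sym Q a b x y : chain Q a b x y -> chain Q x y a b.
Proof.
elim=> {x y} [|x y _ IH|x y z _ IH Qxy Qxz yz]; first exact: chain_refl.
  exact: chain_trans (chain_flip (chain_refl _ _ _)) IH.
apply: chain_trans IH; apply: chain_slide (chain_refl _ _ _) Qxz Qxy _.
exact: cE_sym.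
Qed.

Lemma chain_act Q Q' g a b x y : (forall x y, Q x y -> Q' (cact g x) (cact g y)) ->
  chain Q a b x y -> chain Q' (cact g a) (cact g b) (cact g x) (cact g y).
Proof.
move=> QQ'; elim=> {x y} [|x y _ IH|x y z _ IH Qxy Qxz yz]; first exact: chain_refl.
  exact: chain_flip.
by apply: chain_slide IH _ _ _; [exact: QQ'|exact: QQ'|exact: cE_act].
Qed.

Lemma chain_sub Q Q' a b x y : (forall x y, Q x y -> Q' x y) ->
  chain Q a b x y -> chain Q' a b x y.
Proof.
move=> QQ'; elim=> {x y} [|x y _ IH|x y z _ IH Qxy Qxz yz]; first exact: chain_refl.
  exact: chain_flip.
by apply: chain_slide IH _ _ _ => //; exact: QQ'.
Qed.

Lemma chain_in Q a b x y : (forall x y, Q x y -> Q y x) -> Q a b -> chain Q a b x y -> Q x y.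
Proof. by move=> QC Qab; elim=> {x y} // x y _; exact: QC. Qed.

Lemma chain_invariant Q (Y : Type) (F : X -> X -> Y) a b x y :
  (forall x y, Q x y -> Q y x) -> Q a b ->
  (forall x y, Q x y -> F x y = F y x) ->
  (forall x y z, Q x y -> Q x z -> cE y z -> F x y = F x z) ->
  chain Q a b x y -> F a b = F x y.
Proof.
move=> QC Qab Fflip Fslide; elim=> {x y} // [x y ch ->|x y z _ -> Qxy Qxz yz].
  by apply: Fflip; apply: chain_in ch.
exact: Fslide.
Qed.

End Chain.

Section Resolution.
Variables (G : groupType) (X : gcomplex G) (T : atree G) (f : X -> T).
Hypothesis f_act : forall g x, f (cact g x) = aact g (f x).
Implicit Types (a b x y z : X) (u v w : T) (g : G).

Notation len := (dist (atreeP T)).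
Notation between := (btw (atreeP T)).

(** The map [f] is thought of as extended to the edges of the complex by geodesics; [on v x y] says
    that the edge [xy] contains a point over [v]. *)
Definition on v x y := cE x y /\ between (f x) v (f y).

Lemma on_sym v x y : on v x y -> on v y x.
Proof. by move=> [xy b]; split; [exact: cE_sym|exact: btw_sym]. Qed.

Lemma on_act g v x y : on v x y -> on (aact g v) (cact g x) (cact g y).
Proof. by move=> [xy b]; split; [exact: cE_act|rewrite !f_act; apply/btw_act]. Qed.

Lemma on_left x y : cE x y -> on (f x) x y.
Proof. by split=> //; exact: btw_left. Qed.

Definition same_point (s t : X * X * T) :=
  s.2 = t.2 /\ chain (on s.2) s.1.1 s.1.2 t.1.1 t.1.2.

(* The vertices of the resolution lying over [v] are the connected components of
   the preimage of [v] in the complex, a point of this preimage being named by the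
   edge of the complex which contains it. *)
Definition rclass (C : set (X * X * T)) : bool :=
  `[< exists2 s, on s.2 s.1.1 s.1.2 & C = same_point s >].

Definition rvertex : choiceType := {C : set (X * X * T) | rclass C}.

Lemma rpoint_subproof x y v : on v x y -> rclass (same_point (x, y, v)).
Proof. by move=> h; apply/asboolP; exists (x, y, v). Qed.

Definition rpoint x y v (h : on v x y) : rvertex := exist rclass _ (rpoint_subproof h).

Lemma rpoint_eqP x y v (h : on v x y) x' y' v' (h' : on v' x' y') :
  rpoint h = rpoint h' <-> v = v' /\ chain (on v) x y x' y'.
Proof.
split=> [[e]|[e ch]].
  have : same_point (x, y, v) (x', y', v').
    by rewrite e; split=> //; exact: chain_refl.
  by [].
apply: val_inj => /=; subst v'; rewrite predeqE => -[[a b] w]; split=> -[/= <- c]; split=> //=.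
  exact: chain_trans (chain_sym ch) c.
exact: chain_trans ch c.
Qed.

Lemma rvertex_spec (c : rvertex) : exists s : X * X * T, exists h : on s.2 s.1.1 s.1.2,
  c = rpoint h.
Proof.
case: c => C hC; have /asboolP[[[x y] v] h e] := hC; exists (x, y, v), h.
exact: val_inj.
Qed.

Lemma rvertex_ind (P : rvertex -> Prop) :
  (forall x y v (h : on v x y), P (rpoint h)) -> forall c, P c.
Proof. by move=> Pp c; have [[[x y] v] [h ->]] := rvertex_spec c; exact: Pp. Qed.

Definition rname (c : rvertex) : X * X * T := projT1 (cid (rvertex_spec c)).

Lemma rnameP c : exists h : on (rname c).2 (rname c).1.1 (rname c).1.2, c = rpoint h.
Proof. exact: projT2 (cid (rvertex_spec c)). Qed.

Lemma rname_on c : on (rname c).2 (rname c).1.1 (rname c).1.2.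
Proof. by case: (rnameP c). Qed.

Lemma rnameK c : rpoint (rname_on c) = c.
Proof. by have [h e] := rnameP c; rewrite [RHS]e; congr rpoint; exact: Prop_irrelevance. Qed.

Definition rproj (c : rvertex) : T := (rname c).2.

Lemma rproj_point x y v (h : on v x y) : rproj (rpoint h) = v.
Proof. by have /rpoint_eqP[] := rnameK (rpoint h). Qed.

Definition ract g c : rvertex := rpoint (on_act g (rname_on c)).

Lemma ract_point g x y v (h : on v x y) : ract g (rpoint h) = rpoint (on_act g h).
Proof.
have /rpoint_eqP[e ch] := rnameK (rpoint h).
apply/rpoint_eqP; split; first by rewrite e.
by apply: chain_act ch => a b; exact: on_act.
Qed.

Lemma rpoint_congr x y v (h : on v x y) x' y' v' (h' : on v' x' y') :
  x = x' -> y = y' -> v = v' -> rpoint h = rpoint h'.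
Proof. by move=> ? ? ?; subst; apply/rpoint_eqP; split=> //; exact: chain_refl. Qed.

Lemma ract1 c : ract 1 c = c.
Proof.
by elim/rvertex_ind: c => x y v h; rewrite ract_point; apply: rpoint_congr;
  rewrite ?cact1 ?aact1.
Qed.

Lemma ractM g h c : ract (g * h) c = ract g (ract h c).
Proof.
by elim/rvertex_ind: c => x y v k; rewrite !ract_point; apply: rpoint_congr;
  rewrite ?cactM ?aactM.
Qed.

Lemma rproj_act g c : rproj (ract g c) = aact g (rproj c).
Proof. by elim/rvertex_ind: c => x y v h; rewrite ract_point !rproj_point. Qed.

Definition radj : rel rvertex := fun c d => `[< exists x y u v (hu : on u x y) (hv : on v x y),
  [/\ aadj u v, c = rpoint hu & d = rpoint hv] >].

Lemma radjP c d : reflect (exists x y u v (hu : on u x y) (hv : on v x y),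
  [/\ aadj u v, c = rpoint hu & d = rpoint hv]) (radj c d).
Proof. exact: asboolP. Qed.

Lemma rproj_adj c d : radj c d -> aadj (rproj c) (rproj d).
Proof. by move=> /radjP[x [y [u [v [hu [hv [uv -> ->]]]]]]]; rewrite !rproj_point. Qed.

Lemma radj_sym : symmetric radj.
Proof.
suff le c d : radj c d -> radj d c by move=> c d; apply/idP/idP; exact: le.
move=> /radjP[x [y [u [v [hu [hv [uv -> ->]]]]]]]; apply/radjP.
by exists x, y, v, u, hv, hu; rewrite (tree_adj_sym (atreeP T)).
Qed.

Lemma radj_irr : irreflexive radj.
Proof.
by move=> c; apply/negP => /rproj_adj; rewrite (tree_adj_irr (atreeP T)).
Qed.

Lemma radj_act g c d : radj (ract g c) (ract g d) = radj c d.
Proof.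
suff le h (a b : rvertex) : radj a b -> radj (ract h a) (ract h b).
  apply/idP/idP; last exact: le.
  by move=> /(le g^-1); rewrite -!ractM mulVg !ract1.
move=> /radjP[x [y [u [v [hu [hv [uv -> ->]]]]]]]; apply/radjP.
exists (cact h x), (cact h y), (aact h u), (aact h v), (on_act h hu), (on_act h hv).
by rewrite aact_adj !ract_point.
Qed.

Lemma radj_no_inversion g c d : radj c d -> ~ (ract g c = d /\ ract g d = c).
Proof.
move=> /rproj_adj cd [/(congr1 rproj) + /(congr1 rproj)]; rewrite !rproj_act => e1 e2.
exact: (ano_inversion (g := g) cd).
Qed.

Definition rstar x : rvertex := rpoint (on_left (cE_refl x)).

Lemma rstar_left x y (h : on (f x) x y) : rpoint h = rstar x.
Proof.
apply/rpoint_eqP; split=> //; apply: chain_sym.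
apply: (chain_slide (chain_refl _ _ _) _ h); last exact: h.1.
exact/on_left/cE_refl.
Qed.

Lemma rpoint_flip x y v (h : on v x y) : rpoint h = rpoint (on_sym h).
Proof. by apply/rpoint_eqP; split=> //; apply/chain_flip/chain_refl. Qed.

Lemma rstar_right x y (h : on (f y) x y) : rpoint h = rstar y.
Proof. by rewrite rpoint_flip rstar_left. Qed.

Lemma rstar_act g x : rstar (cact g x) = ract g (rstar x).
Proof. by rewrite ract_point; apply: rpoint_congr; rewrite ?f_act. Qed.

Lemma rpath x y v (h : on v x y) :
  exists s, [/\ path radj (rstar x) s, last (rstar x) s = rpoint h & size s = len (f x) v].
Proof.
move e : (len (f x) v) => k; elim: k v h e => [|k IH] v h e.
  move: h; rewrite -(dist_eq0 e) => h; exists [::]; split=> //; by rewrite /= rstar_left.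
have [w wv xw] := dist_pred e.
have hw : on w x y.
  split; first exact: h.1.
  apply: (btw_trans h.2); by rewrite /btw xw (adj_dist _ wv) e addn1.
have [s [ps sw sk]] := IH w hw xw; exists (rcons s (rpoint h)).
rewrite rcons_path last_rcons size_rcons ps sw sk; split=> //.
by apply/radjP; exists x, y, w, v, hw, h.
Qed.

Lemma rwalk c d : walk radj c d.
Proof.
have wx x y v (h : on v x y) : walk radj (rstar x) (rpoint h).
  by have [s [ps sh _]] := rpath h; exists s.
have ws : forall x y, walk radj (rstar x) (rstar y).
  move=> x t; apply: (@cE_connected _ X (fun y => walk radj (rstar x) (rstar y)) _ x t);
    last exact: walk_refl.
  move=> y z yz xy; apply: walk_trans xy _.
  have h : on (f z) y z by apply/on_sym/on_left/cE_sym.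
  by rewrite -(rstar_right h); exact: wx.
elim/rvertex_ind: c => x y u hu; elim/rvertex_ind: d => x' y' v hv.
apply: (walk_trans _ (wx _ _ _ hv)); apply: (walk_trans _ (ws x x')).
by apply: walk_sym; [exact: radj_sym|exact: wx].
Qed.

(** For adjacent [u] and [v], the edge [xy] passes over the midpoint of [uv]. The chains for
    [crosses u v] are the tracks over this midpoint. *)
Definition crosses u v x y := on u x y /\ on v x y.

Lemma crosses_sym u v x y : crosses u v x y -> crosses u v y x.
Proof. by move=> [hu hv]; split; exact: on_sym. Qed.

Section Track.
Variables (u v : T).
Hypothesis uv : aadj u v.

Notation sd := (side (atreeP T) u v).

Lemma crossesP x y : cE x y -> crosses u v x y <-> sd (f x) <> sd (f y).
Proof.
move=> xy; split=> [[[_ bu] [_ bv]]|sxy].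
  have h1 := adj_dist_cases (atreeP T) (f x) uv; have h2 := adj_dist_cases (atreeP T) (f y) uv.
  move: bu bv; rewrite /btw /side => bu bv.
  rewrite (dist_sym _ (f x) u) (dist_sym _ (f x) v) (dist_sym _ (f y) u) (dist_sym _ (f y) v).
  rewrite (dist_sym _ (f x) u) in bu; rewrite (dist_sym _ (f x) v) in bv.
  by move=> e; lia.
have cs := side_cut (atreeP T) uv.
have [p [q [pq bp bq d [sp sq]]]] := cut_crossed (atreeP T) cs sxy.
have spq : sd p <> sd q by rewrite sp sq.
by case: (cs.2 _ _ pq spq) => -[e1 e2]; subst; split; split.
Qed.

(** The track through [x0 y0] is dual to a cocycle modulo 2, hence separates the complex, and this
    separation descends to the resolution. The second conclusion, that only edges on the track are
    separated, identifies the track from the edge of the resolution it defines. *)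
Lemma track_cut x0 y0 (hu : on u x0 y0) (hv : on v x0 y0) :
  exists s, cut radj (rpoint hu) (rpoint hv) s /\
    forall x y (ku : on u x y) (kv : on v x y),
      s (rpoint ku) <> s (rpoint kv) -> chain (crosses u v) x0 y0 x y.
Proof.
pose d x y := `[< chain (crosses u v) x0 y0 x y >].
have dP x y : reflect (chain (crosses u v) x0 y0 x y) (d x y) by exact: asboolP.
have d_cross x y : d x y -> crosses u v x y.
  by move=> /dP; apply: chain_in => // a b; exact: crosses_sym.
have d_flip x y : d x y = d y x by apply/dP/dP; exact: chain_flip.
have d_slide x y z : crosses u v x y -> crosses u v x z -> cE y z -> d x y = d x z.
  move=> xy xz yz; apply/dP/dP => ch; first exact: chain_slide ch xy xz yz.
  by apply: chain_slide ch xz xy _; exact: cE_sym.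
have d0 x y : cE x y -> sd (f x) = sd (f y) -> d x y = false.
  by move=> xy e; apply/negP => /d_cross/(crossesP xy).
have dS x y z : cE x y -> cE x z -> cE y z -> sd (f x) <> sd (f y) -> sd (f x) <> sd (f z) ->
    d x y = d x z.
  by move=> xy xz yz sy sz; apply: d_slide yz; apply/crossesP.
(* The midpoint of [uv] is crossed by none or by exactly two sides of a triangle, and these two are
   related by a slide, so the track contains both or neither: [d] is a cocycle. *)
have [x y z xy yz xz|s sP] := @cE_coboundary _ X d.
  have yx := cE_sym xy; have zy := cE_sym yz; have zx := cE_sym xz.
  case: (boolP (sd (f x) == sd (f y))) => /eqP sxy.
    rewrite (d0 x y)//= d_flip [RHS]d_flip.
    case: (boolP (sd (f x) == sd (f z))) => /eqP sxz.
      by rewrite !d0// ?sxz// -sxz.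
    by apply: dS => // e; apply: sxz; congruence.
  case: (boolP (sd (f x) == sd (f z))) => /eqP sxz.
    rewrite (d0 x z)// d_flip (dS y x z)//; first by rewrite addbb.
      by move=> e; apply: sxy.
    by move=> e; apply: sxy; rewrite sxz.
  rewrite (d0 y z) ?addbF//; first by apply: dS.
  by case: (sd (f x)) (sd (f y)) (sd (f z)) sxy sxz => [] [] [].
(* The point over [w] on the edge [xy] receives the value of [s] at the end of [xy] lying on the
   same side of [uv] as [w]. *)
pose F x y w := if sd w == sd (f x) then s x else s y.
have sE x y : cE x y -> sd (f x) = sd (f y) -> s x = s y.
  by move=> xy e; have := sP _ _ xy; rewrite d0//; case: (s x) (s y) => [] [].
have cs := side_cut (atreeP T) uv.
have F_chain w x y x' y' : on w x y -> chain (on w) x y x' y' -> F x y w = F x' y' w.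
  move=> h; apply: (chain_invariant (F := fun x y => F x y w)) => // {h x y x' y'}.
  - by move=> x y; exact: on_sym.
  - move=> x y [xy b]; rewrite /F.
    case: (boolP (sd (f x) == sd (f y))) => /eqP e.
      by rewrite (cut_convex cs b e) e eqxx (sE _ _ xy).
    by case: (sd w) (sd (f x)) (sd (f y)) e => [] [] [].
  - move=> x y z [xy by_] [xz bz] yz; rewrite /F; case: eqP => // e.
    have ne t : between (f x) w (f t) -> sd (f x) <> sd (f t).
      by move=> b e'; apply: e; exact: (cut_convex cs b e').
    apply: sE => //; move: (ne _ by_) (ne _ bz).
    by case: (sd (f x)) (sd (f y)) (sd (f z)) => [] [] [].
pose S (c : rvertex) := F (rname c).1.1 (rname c).1.2 (rname c).2.
have SE x y w (h : on w x y) : S (rpoint h) = F x y w.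
  have /rpoint_eqP[e ch] := rnameK (rpoint h).
  rewrite /S; move: (rname_on (rpoint h)) e ch; case: (rname _) => [[a b] c] /= k e ch.
  by subst c; exact: F_chain ch.
have S_change x y w w' (h : on w x y) (h' : on w' x y) :
    S (rpoint h) <> S (rpoint h') -> sd w <> sd w' /\ d x y.
  rewrite !SE /F sP; last exact: h.1.
  by case: (sd w) (sd w') (sd (f x)) (s x) (s y) => [] [] [] [] [].
exists S; split; last first.
  by move=> x y ku kv ne; have [_ /dP] := S_change _ _ _ _ _ _ ne.
split.
  rewrite !SE /F; have sxy : s x0 <> s y0.
    move=> e; have := sP x0 y0 hu.1; rewrite e addbb => /dP; apply; exact: chain_refl.
  case: cs => suv _.
  by case: (sd u) (sd v) suv (sd (f x0)) (s x0) (s y0) sxy => [] [] // _ [] [] [].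
move=> a b /radjP[x [y [w [w' [h [h' [ww' -> ->]]]]]]] ne.
have [sww' /dP ch] := S_change _ _ _ _ _ _ ne.
have eu (hu' : on u x y) : rpoint hu' = rpoint hu.
  by apply/rpoint_eqP; split=> //; apply: chain_sym; apply: chain_sub ch => ? ? [].
have ev (hv' : on v x y) : rpoint hv' = rpoint hv.
  by apply/rpoint_eqP; split=> //; apply: chain_sym; apply: chain_sub ch => ? ? [].
by case: (cs.2 _ _ ww' sww') => -[e1 e2]; subst; [left|right]; rewrite eu ev.
Qed.

End Track.

Lemma rtreeP : is_tree radj.
Proof.
apply: is_tree_of_cuts; first by exists (rstar (cbase X)).
- exact: radj_sym.
- exact: radj_irr.
- exact: rwalk.
move=> c d /radjP[x [y [u [v [hu [hv [uv -> ->]]]]]]].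
by have [s [cs _]] := track_cut uv hu hv; exists s.
Qed.

End Resolution.

(** * Edge stabilizers of the resolution *)

Lemma finite_interval (G : groupType) (T : atree G) (x y : T) :
  finite_set [set z | btw (atreeP T) x z y].
Proof.
apply: sub_finite_set (finite_image (point x y) (finite_II (dist (atreeP T) x y).+1)).
move=> z /= b; exists (dist (atreeP T) x z); first by move: b; rewrite /btw /=; lia.
exact: point_eq.
Qed.

Lemma finite_subsingleton (T : Type) (A : set T) :
  (forall x y, A x -> A y -> x = y) -> finite_set A.
Proof.
move=> A1; have [->|/set0P[x Ax]] := eqVneq A set0; first exact: finite_set0.
by apply: sub_finite_set (finite_set1 x) => y /(A1 x) ->.
Qed.

(** One element of [A] is picked for each label that occurs, with [a0] as default, and [a0] itself
    is added. *)
Lemma finite_transversal (P L : choiceType) (A : set P) (B : set L) (lab : P -> L -> Prop) a0 :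
  A a0 -> finite_set B -> (forall a, A a -> exists2 l, B l & lab a l) ->
  exists R : set P, [/\ finite_set R, R a0, R `<=` A &
    forall a, A a -> exists r l, [/\ R r, lab a l & lab r l]].
Proof.
move=> A0 finB AB; pose r l := xget a0 [set a | A a /\ lab a l].
have Ar l : A (r l) by rewrite /r; case: xgetP => // a _ [].
exists (a0 |` r @` B); split.
- by rewrite finite_setU; split; [exact: finite_set1|exact: finite_image].
- by left.
- by move=> _ [->//|[l _ <-]].
move=> a Aa; have [l Bl al] := AB _ Aa; exists (r l), l; split=> //.
  by right; exists l.
by have [] : A (r l) /\ lab (r l) l by apply: (@xgetPex _ a0 [set a | A a /\ lab a l]); exists a.
Qed.

Section Stabilizer.
Variables (G : groupType) (T : atree G) (x y : T).

Definition fixator : set G := [set g | aact g x = x /\ aact g y = y].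

Lemma fixator_subproof : group_closed (mem fixator).
Proof.
have fixV (z : T) g : aact g z = z -> aact g^-1 z = z by move=> gz; rewrite -{1}gz aactK.
split; first by apply/mem_set; split; exact: aact1.
move=> g h /set_mem[gx gy] /set_mem[hx hy]; apply/mem_set.
by split; rewrite aactM fixV.
Qed.

Definition fixator_subgroup : subgroup G := Subgroup fixator_subproof.

End Stabilizer.

Section SubgroupLemmas.
Variables (G : groupType) (K : subgroup G).

Lemma subgroup1 : K 1.
Proof. by have [/set_mem] := subgroupP K. Qed.

Lemma subgroup_div g h : K g -> K h -> K (g / h).
Proof.
have [_ KD] := subgroupP K; move=> /mem_set Kg /mem_set Kh.
exact/set_mem/KD.
Qed.

Lemma subgroupV g : K g -> K g^-1.
Proof. by move=> Kg; rewrite -[g^-1]mul1g; apply: subgroup_div => //; exact: subgroup1. Qed.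

Lemma subgroupM g h : K g -> K h -> K (g * h).
Proof. by move=> Kg Kh; rewrite -[h]invgK; apply: subgroup_div => //; exact: subgroupV. Qed.

End SubgroupLemmas.

Section ResolutionTree.
Variables (G : groupType) (X : gcomplex G) (T : atree G) (f : X -> T).
Hypothesis f_act : forall g x, f (cact g x) = aact g (f x).
Implicit Types (a b x y z : X) (u v w : T) (g : G).

Notation len := (dist (atreeP T)).
Notation between := (btw (atreeP T)).

Definition resolution : atree G :=
  ATree (rtreeP f) (ract1 f_act) (ractM f_act) (radj_act f_act)
    (@radj_no_inversion _ _ _ _ f_act).

Definition star x : resolution := rstar f x.

Lemma star_act g x : star (cact g x) = aact g (star x).
Proof. exact: rstar_act. Qed.

Notation lenR := (dist (atreeP resolution)).
Notation betweenR := (btw (atreeP resolution)).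

Lemma rproj_aact g (c : resolution) : rproj (aact g c) = aact g (rproj c).
Proof. exact: rproj_act. Qed.

Lemma dist_rproj (c d : resolution) : (len (rproj c) (rproj d) <= lenR c d)%N.
Proof.
have [s [ps <- <-]] := distP (atreeP resolution) c d.
rewrite -(size_map (@rproj _ _ _ f)); apply: dist_le; last by rewrite last_map.
rewrite path_map; apply: sub_path ps => a b; exact: rproj_adj.
Qed.

(** The projection to [T] does not increase distances, and [rpath] provides a path of the required
    length. *)
Lemma dist_star_point x y v (h : on f v x y) : lenR (star x) (rpoint h) = len (f x) v.
Proof.
apply/eqP; rewrite eqn_leq; apply/andP; split.
  by have [s [ps sh <-]] := rpath h; exact: dist_le.
by have := dist_rproj (star x) (rpoint h); rewrite !rproj_point.
Qed.

Lemma between_stars x y v (h : on f v x y) : betweenR (star x) (rpoint h) (star y).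
Proof.
rewrite /btw [lenR (rpoint h) _]dist_sym dist_star_point rpoint_flip dist_star_point.
have xy := h.1; have := h.2; rewrite /btw (dist_sym _ v) => ->.
have -> : star y = rpoint (on_sym (on_left f (cE_sym xy))) by rewrite rstar_right.
by rewrite dist_star_point.
Qed.

(** Each edge of the resolution gets the [D]-length of its projection. The segment of the resolution
    above an edge of [X] projects isometrically, so the total is unchanged there. *)
Lemma additive_lift (D : T -> T -> rat) : additive D ->
  exists2 D' : resolution -> resolution -> rat, additive D' &
    forall x y, cE x y -> D' (star x) (star y) = D (f x) (f y).
Proof.
move=> aD; pose w (c d : resolution) := D (rproj c) (rproj d).
have aw : additive (edge_sum w).
  apply: additive_edge_sum => [g c d|c d]; last exact: (additive_sym aD).
  by rewrite /w !rproj_aact additive_act.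
exists (edge_sum w) => // x y xy.
suff lift v (h : on f v x y) : edge_sum w (star x) (rpoint h) = D (f x) v.
  have h := on_sym (on_left f (cE_sym xy)).
  by rewrite -(lift _ h) rstar_right.
move e : (len (f x) v) => k; elim: k v h e => [|k IH] v h e.
  by move: h; rewrite -(dist_eq0 e) => h; rewrite rstar_left !additivexx.
have [u uv xu] := dist_pred e.
have bu : between (f x) u v by rewrite /btw xu (adj_dist _ uv) e addn1.
have hu : on f u x y by split=> //; exact: btw_trans h.2 bu.
have adjh : aadj (rpoint hu : resolution) (rpoint h).
  by apply/radjP; exists x, y, u, v, hu, h.
have bR : betweenR (star x) (rpoint hu) (rpoint h).
  by rewrite /btw !dist_star_point (adj_dist _ adjh) xu e addn1.
rewrite (additive_btw aw bR) (additive_btw aD bu) (IH _ hu xu); congr (_ + _)%R.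
by rewrite edge_sum_adj// /w !rproj_point.
Qed.

(** Every vertex lies on the segment between the stars of the ends of some edge of [X], and up to
    translation there are finitely many such segments. *)
Lemma resolution_cofinite : exists2 B : set resolution, finite_set B &
  forall x y u v (hu : on f u x y) (hv : on f v x y),
    exists g, B (aact g (rpoint hu : resolution)) /\ B (aact g (rpoint hv : resolution)).
Proof.
have [m [p [q [_ pq]]]] := cE_cofinite X.
exists (\bigcup_(k in [set: 'I_m]) [set c | betweenR (star (p k)) c (star (q k))]).
  apply: bigcup_finite => [|k _]; last exact: finite_interval.
  exact: finite_finset.
move=> x y u v hu hv; have [k [g [xg yg]]] := pq _ _ hu.1.
exists g^-1; split; exists k => //.
all: apply: (@btw_act _ resolution g _ _ _).1; rewrite aactKV -!star_act -xg -yg; exact: between_stars.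
Qed.

Section EdgeFixator.
Variables (x0 y0 : X) (u v : T) (hu : on f u x0 y0) (hv : on f v x0 y0).
Hypothesis uv : aadj u v.
Let c : resolution := rpoint hu.
Let d : resolution := rpoint hv.
Let K := fixator_subgroup c d.

Let track (s : X * X) := chain (crosses f u v) x0 y0 s.1 s.2.

Let track_crosses s : track s -> crosses f u v s.1 s.2.
Proof. by apply: chain_in; [move=> a b; exact: crosses_sym|split]. Qed.

Let pact g (s : X * X) := (cact g s.1, cact g s.2).

Let pactM g h s : pact (g * h) s = pact g (pact h s).
Proof. by rewrite /pact !cactM. Qed.

Let pact1 s : pact 1 s = s.
Proof. by case: s => a b; rewrite /pact !cact1. Qed.

Let track_point s (hu' : on f u s.1 s.2) (hv' : on f v s.1 s.2) : track s ->
  rpoint hu' = c /\ rpoint hv' = d.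
Proof.
move=> /chain_sym t; split; apply/rpoint_eqP; split=> //; by apply: chain_sub t => ? ? [].
Qed.

(** The translated edge still passes through both [c] and [d], which the cut of the track separates,
    so it belongs to the track. *)
Let fixes_track g s : track s -> K g -> track (pact g s).
Proof.
move=> ts [gc gd]; have [hu' hv'] := track_crosses ts.
have [ec ed] := track_point hu' hv' ts.
have gu : aact g u = u by have := congr1 (@rproj _ _ _ f) gc; rewrite rproj_act !rproj_point.
have gv : aact g v = v by have := congr1 (@rproj _ _ _ f) gd; rewrite rproj_act !rproj_point.
have [r [[rcd _] r_track]] := track_cut uv hu hv.
have ku : on f u (cact g s.1) (cact g s.2) by rewrite -gu; exact: on_act.
have kv : on f v (cact g s.1) (cact g s.2) by rewrite -gv; exact: on_act.
apply: (r_track _ _ ku kv).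
have -> : rpoint ku = c by rewrite -gc -ec /aact/= ract_point; exact: rpoint_congr.
by have -> : rpoint kv = d by rewrite -gd -ed /aact/= ract_point; exact: rpoint_congr.
Qed.

(** Equal distances from the first end identify the points over [u] and [v] on the translated edge
    with the translates of those on [s], so [g] fixes [u] and [v], then [c] and [d]. *)
Let fixes_of_track g s : track s -> track (pact g s) ->
  len (f (pact g s).1) u = len (f s.1) u -> len (f (pact g s).1) v = len (f s.1) v -> K g.
Proof.
move=> ts tgs du dv; have [hu1 hv1] := track_crosses ts; have [hu2 hv2] := track_crosses tgs.
have [ec1 ed1] := track_point hu1 hv1 ts; have [ec2 ed2] := track_point hu2 hv2 tgs.
have fixp w : on f w s.1 s.2 -> on f w (cact g s.1) (cact g s.2) ->
    len (f (cact g s.1)) w = len (f s.1) w -> aact g w = w.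
  move=> h1 h2 dw; apply: (btw_uniq (on_act f_act g h1).2 h2.2).
  by rewrite dw f_act dist_act.
split; [rewrite -[in LHS]ec1 -ec2|rewrite -[in LHS]ed1 -ed2]; rewrite /aact/= ract_point;
  apply: rpoint_congr => //; exact: fixp.
Qed.

(** The moves generating [chain]. The case [t = s] lets the generating set below contain the
    elements of [K] that carry one member of [R] to another. *)
Let step (s : X * X) : set (X * X) :=
  [set t | t = s \/ t = (s.2, s.1) \/ [/\ t.1 = s.1, cE s.1 t.2 & cE s.2 t.2]].

Let step_act g s t : step s t -> step (pact g s) (pact g t).
Proof.
move=> [->|[->|[e h1 h2]]]; [by left|by right; left|right; right].
by split; rewrite /= ?e//; exact: cE_act.
Qed.

Let track_neq s : track s -> s.1 <> s.2.
Proof. by move=> /track_crosses h e; case/(crossesP f uv h.1.1): h; rewrite e. Qed.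

Let step_finite s : track s -> finite_set (step s).
Proof.
move=> ts; have fin := cE_finite_link (track_crosses ts).1.1 (track_neq ts).
apply: (@sub_finite_set _ _ ([set s; (s.2, s.1)] `|`
  (fun z => (s.1, z)) @` [set z | cE s.1 z /\ cE s.2 z])).
  move=> t [->|[->|[e h1 h2]]]; [by left; left|by left; right|right].
  by exists t.2 => //; rewrite -e; case: (t).
by rewrite finite_setU; split; [exact: finite_set2|exact: finite_image].
Qed.

(** [K] acts on the track, which is connected under [step], locally finite and finite modulo [K],
    and the stabilizers of its members are trivial. The elements moving a finite transversal next to
    itself then generate [K]. *)
Lemma fixator_finitely_generated : finitely_generated (fixator c d).
Proof.
have [m [p [q [_ pq]]]] := cE_cofinite X.
pose N := \max_(k < m) len (f (p k)) (f (q k)).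
(* The label of [s] is its orbit under [G] together with the positions of [u] and [v] along it,
   bounded by [N]; by [fixes_of_track], equal labels mean the same orbit under [K]. *)
pose lab (s : X * X) (l : 'I_m * nat * nat) :=
  [/\ exists g, s = pact g (p l.1.1, q l.1.1), l.1.2 = len (f s.1) u & l.2 = len (f s.1) v].
have t0 : track (x0, y0) by exact: chain_refl.
have [R [finR R0 RT Rlab]] : exists R : set (X * X), [/\ finite_set R, R (x0, y0), R `<=` track &
    forall s, track s -> exists r l, [/\ R r, lab s l & lab r l]].
  apply: (@finite_transversal _ _ track ([set: 'I_m] `*` `I_N.+1 `*` `I_N.+1) lab) => //.
    by apply: finite_setX; [apply: finite_setX|]; [exact: finite_finset|exact: finite_II..].
  move=> s /track_crosses[[sE b1] [_ b2]]; have [k [g [e1 e2]]] := pq _ _ sE.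
  exists (k, len (f s.1) u, len (f s.1) v).
    have : (len (f s.1) (f s.2) <= N)%N.
      by rewrite e1 e2 !f_act dist_act; exact: (@leq_bigmax _ (fun k => len (f (p k)) (f (q k)))).
    by move: b1 b2; rewrite /btw /= => b1 b2; repeat split => //=; lia.
  by split=> //; exists g; case: (s) e1 e2 => a b /= -> ->.
have Rorb s : track s -> exists r g, [/\ R r, K g & s = pact g r].
  move=> ts; have [r [l [Rr [[g1 sg] i1 j1] [[g2 rg] i2 j2]]]] := Rlab _ ts.
  have e : s = pact (g1 * g2^-1) r by rewrite rg -pactM mulgVK.
  exists r, (g1 * g2^-1); split=> //.
  by apply: (@fixes_of_track _ r); rewrite -?e -?i1 -?i2 -?j1 -?j2//; exact: RT.
pose S : set G := [set g | K g /\ exists r r', [/\ R r, R r' & step r (pact g r')]].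
exists S.
  apply: (@sub_finite_set _ _ (\bigcup_(r in R) \bigcup_(r' in R) \bigcup_(t in step r)
     [set g | t = pact g r'])).
    by move=> g [_ [r [r' [Rr Rr' rt]]]]; exists r => //; exists r' => //; exists (pact g r').
  apply: bigcup_finite => // r Rr; apply: bigcup_finite => // r' Rr'.
  apply: bigcup_finite => [|t _]; first exact/step_finite/RT.
  apply: finite_subsingleton => g h /= -> e.
  (* For given [r'] and [t], at most one [g] carries [r'] to [t], since the action on nondegenerate
     edges is free. *)
  have tr := RT _ Rr'; suff e1 : h^-1 * g = 1.
    by rewrite -[g]mul1g -(mulgV h) -mulgA e1 mulg1.
  have e' : pact (h^-1 * g) r' = r' by rewrite pactM e -pactM mulVg pact1.
  apply: (cE_free (track_crosses tr).1.1 (track_neq tr)).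
    exact: (congr1 fst e').
  exact: (congr1 snd e').
rewrite predeqE => g; split=> [gS|Kg].
  by apply: (gS K) => h [].
move=> L SL.
have next k r s : K k -> L k -> R r -> track s -> step (pact k r) s ->
    exists r k, [/\ K k, L k, R r & s = pact k r].
  move=> Kk Lk Rr ts st; have [r' [g' [Rr' Kg' e]]] := Rorb _ ts.
  exists r', g'; split=> //.
  have -> : g' = k * (k^-1 * g') by rewrite mulgA mulgV mul1g.
  apply: subgroupM => //; apply: SL; split; first by apply: subgroupM => //; exact: subgroupV.
  exists r, r'; split=> //; rewrite pactM -e.
  by have := step_act k^-1 st; rewrite -pactM mulVg pact1.
have reach s : track s -> exists r k, [/\ K k, L k, R r & s = pact k r].
  case: s => a b; rewrite /track /= => ch.
  elim: ch => {a b} [|a b ch [r [k [Kk Lk Rr e]]]|a b z ch [r [k [Kk Lk Rr e]]] Qab Qaz bz].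
  - by exists (x0, y0), 1; rewrite pact1; split=> //; [exact: (subgroup1 K)|exact: (subgroup1 L)].
  - apply: (next k r) => //; first exact: chain_flip.
    by rewrite -e; right; left.
  - apply: (next k r) => //; first exact: chain_slide ch Qab Qaz bz.
    by rewrite -e; right; right; split=> //; exact: Qaz.1.1.
have [r [k [Kk Lk Rr e]]] := reach _ (fixes_track t0 Kg).
have -> : g = k * (k^-1 * g) by rewrite mulgA mulgV mul1g.
apply: subgroupM => //; apply: SL; split; first by apply: subgroupM => //; exact: subgroupV.
exists r, (x0, y0); split=> //; left.
by rewrite pactM e -pactM mulVg pact1.
Qed.

End EdgeFixator.

End ResolutionTree.

(** * Blowing up the vertices of a tree *)

(* The tree obtained from [S] by replacing each vertex by a copy of [T], the edge
   [st] of [S] being attached at the points [p s t] and [p t s]. *)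
Section Blowup.
Variables (G : groupType) (S T : atree G) (p : S -> S -> T).
Hypothesis p_act : forall g s t, aadj s t -> p (aact g s) (aact g t) = aact g (p s t).

Let V : choiceType := (S * T)%type.
Implicit Types (c d : V).

Definition badj : rel V := fun c d =>
  ((c.1 == d.1) && aadj c.2 d.2) || [&& aadj c.1 d.1, c.2 == p c.1 d.1 & d.2 == p d.1 c.1].

Definition bact g c : V := (aact g c.1, aact g c.2).

Lemma badjP c d : reflect ((c.1 = d.1 /\ aadj c.2 d.2) \/
  [/\ aadj c.1 d.1, c.2 = p c.1 d.1 & d.2 = p d.1 c.1]) (badj c d).
Proof.
apply: (iffP orP) => -[h|h]; [left|right|left|right].
- by case/andP: h => /eqP.
- by case/and3P: h => ? /eqP ? /eqP.
- by case: h => -> ->; rewrite eqxx.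
- by case: h => -> -> ->; rewrite !eqxx.
Qed.

Lemma badj_sym : symmetric badj.
Proof.
suff le c d : badj c d -> badj d c by move=> c d; apply/idP/idP; exact: le.
move=> /badjP[[e a]|[a e1 e2]]; apply/badjP; [left|right].
  by rewrite (tree_adj_sym (atreeP T)).
by rewrite (tree_adj_sym (atreeP S)).
Qed.

Lemma badj_irr : irreflexive badj.
Proof.
move=> c; apply/negP => /badjP[[_]|[]]; first by rewrite (tree_adj_irr (atreeP T)).
by rewrite (tree_adj_irr (atreeP S)).
Qed.

Lemma badj_act g c d : badj (bact g c) (bact g d) = badj c d.
Proof.
apply/badjP/badjP; rewrite /= !aact_adj => -[[e a]|[a e1 e2]]; [left|right|left|right].
- by split=> //; apply: (can_inj (aactK g)).
- have b : aadj d.1 c.1 by rewrite (tree_adj_sym (atreeP S)).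
  move: e1 e2; rewrite !p_act// => /(can_inj (aactK g)) -> /(can_inj (aactK g)) ->.
  by [].
- by rewrite e.
- have b : aadj d.1 c.1 by rewrite (tree_adj_sym (atreeP S)).
  by rewrite !p_act// e1 e2.
Qed.

Lemma bact1 c : bact 1 c = c.
Proof. by case: c => s t; rewrite /bact !aact1. Qed.

Lemma bactM g h c : bact (g * h) c = bact g (bact h c).
Proof. by rewrite /bact !aactM. Qed.

Lemma badj_no_inversion g c d : badj c d -> ~ (bact g c = d /\ bact g d = c).
Proof.
case: c d => [s t] [s' t'] /badjP[[/= _ a]|[/= a _ _]] [[e1 e2] [e3 e4]].
  exact: (ano_inversion (g := g) a).
exact: (ano_inversion (g := g) a).
Qed.

Lemma bwalk c d : walk badj c d.
Proof.
have fib s t t' : walk badj (s, t) (s, t').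
  have [u [pu <- _]] := distP (atreeP T) t t'.
  elim: u t pu => [t _|t1 u IH t /= /andP[tt1 /IH]]; first exact: walk_refl.
  apply: walk_trans; apply: walk_adj; apply/badjP; by left.
case: c d => [s t] [s' t'].
have [u [pu <- _]] := distP (atreeP S) s s'.
elim: u s t pu => [s t _|s1 u IH s t /= /andP[ss1 /IH w]]; first exact: fib.
apply: (walk_trans (fib s t (p s s1))).
apply: (walk_trans _ (w (p s1 s))).
by apply: walk_adj; apply/badjP; right.
Qed.

Lemma crossing_cut s1 s2 : aadj s1 s2 ->
  cut badj (s1, p s1 s2) (s2, p s2 s1) (fun c => side (atreeP S) s1 s2 c.1).
Proof.
move=> s12; have cs := side_cut (atreeP S) s12; split; first exact: cs.1.
move=> [a b] [c d] /badjP[[/= -> _]//|[/= ac -> ->]] /(cs.2 _ _ ac)[[-> ->]|[-> ->]].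
  by left.
by right.
Qed.

(** Project the blow-up to the copy of [T] over [s]: a vertex over another [s'] goes to the
    attaching point of the first edge of the segment from [s] to [s']. The two ends of an edge
    joining distinct copies have the same projection, so a cut of [T] pulls back. *)
Lemma fiber_cut s t1 t2 : aadj t1 t2 -> exists r, cut badj (s, t1) (s, t2) r.
Proof.
move=> t12; have cs := side_cut (atreeP T) t12.
pose r (c : V) := side (atreeP T) t1 t2 (if c.1 == s then c.2 else p s (point s c.1 1)).
have r_cross a b : aadj a b -> r (a, p a b) = r (b, p b a).
  have main a' b' : aadj a' b' ->
      (dist (atreeP S) s b' = (dist (atreeP S) s a').+1)%N -> r (a', p a' b') = r (b', p b' a').
    move=> ab d; rewrite /r /=; have -> : (b' == s) = false.
      by apply/eqP => e; move: d; rewrite e dist0.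
    have bab : btw (atreeP S) s a' b' by rewrite /btw (adj_dist _ ab) d addn1.
    case: eqP => [e|/eqP ne].
      subst s; rewrite (@point_eq _ _ a' b' b' 1)//; first exact: btw_right.
      exact: adj_dist.
    have le : (1 <= dist (atreeP S) s a')%N.
      rewrite lt0n; apply: contra ne => /eqP e0; by rewrite (dist_eq0 e0).
    have [bp dp] := pointP le.
    by rewrite (@point_eq _ _ s b' _ 1 _ dp)//; apply: btw_trans bab bp.
  move=> ab; have := adj_dist_cases (atreeP S) s ab; rewrite !(dist_sym _ _ s).
  case=> d; first exact: main.
  by rewrite [RHS]main// (tree_adj_sym (atreeP S)).
exists r; split; first by rewrite /r /= eqxx; exact: cs.1.
move=> [a b] [c d] /badjP[[/= -> bd]|[/= ac -> ->]]; last by rewrite r_cross.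
rewrite /r /=; case: eqP => // -> /(cs.2 _ _ bd)[[-> ->]|[-> ->]]; by [left|right].
Qed.

Lemma btreeP : is_tree badj.
Proof.
apply: is_tree_of_cuts.
- have [s _] := tree_nonempty (atreeP S); have [t _] := tree_nonempty (atreeP T).
  by exists (s, t).
- exact: badj_sym.
- exact: badj_irr.
- exact: bwalk.
move=> [s t] [s' t'] /badjP[[/= <- tt']|[/= ss' -> ->]]; first exact: fiber_cut.
by eexists; exact: crossing_cut.
Qed.

Definition blowup : atree G := ATree btreeP bact1 bactM badj_act badj_no_inversion.

(** Otherwise an edge of [S] at [z.1] separates it from both [a.1] and [b.1], and the cut of the
    corresponding edge of the blow-up contradicts convexity. *)
Lemma blowup_btw (a z b : blowup) :
  btw (atreeP blowup) a z b -> btw (atreeP S) a.1 z.1 b.1.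
Proof.
move=> bz; case: (btw_or_neighbor (atreeP S) a.1 z.1 b.1) => [//|[y [zy ya yb]]].
have := cut_convex (crossing_cut zy) bz; rewrite /side dist0.
by rewrite !(dist_sym _ _ y) !(dist_sym _ _ z.1) yb ya !ltnS !leqnn ltn0 => /(_ erefl).
Qed.

Lemma additive_blowup (D : S -> S -> rat) : additive D ->
  additive (fun c d : blowup => D c.1 d.1).
Proof.
move=> aD; split=> [g c d|c d|c z d /blowup_btw b].
- by rewrite additive_act.
- by rewrite (additive_sym aD).
- exact: additive_btw.
Qed.

End Blowup.

(** * Transferring vertex stabilizers through equal lengths *)

Section LengthPoint.
Variables (G : groupType) (T : atree G) (D : T -> T -> rat).
Hypothesis aD : additive D.
Hypothesis D_gt0 : forall x y, x <> y -> (0 < D x y)%R.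
Implicit Types (a b c m v w x y z : T) (j : rat).

Notation len := (dist (atreeP T)).
Notation between := (btw (atreeP T)).

Let D_ge0 x y : (0 <= D x y)%R.
Proof.
have [->|/eqP/D_gt0/Order.POrderTheory.ltW//] := eqVneq x y.
by rewrite additivexx.
Qed.

(** The last vertex met on the way from [a] to [b] within [D]-length [j]. *)
Definition last_before a b j v := [/\ between a v b, (D a v <= j)%R &
  forall z, between a z b -> (D a z <= j)%R -> (D a z <= D a v)%R].

(* The vertices closest on either side to the point at [D]-length [j] from [a] on
   the segment [ab]: this vertex itself, or the ends of the edge containing it. *)
Definition near_point a b j v := last_before a b j v \/ last_before b a (D a b - j)%R v.

Lemma between_cases a b m z : between a m b -> between a z b ->
  between a z m \/ between a m z.
Proof.
move=> bm bz; case/orP: (leq_total (len a z) (len a m)) => le; [left|right].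
  exact: btw_restrict bm bz le.
exact: btw_restrict bz bm le.
Qed.

Lemma between_le a b m z : between a m b -> between a z b -> (D a z <= D a m)%R -> between a z m.
Proof.
move=> bm bz le; case: (between_cases bm bz) => // bmz.
have := additive_btw aD bmz => e; have [->|/eqP/D_gt0] := eqVneq m z; first exact: btw_right.
by lra.
Qed.

Lemma last_before_uniq a b j v w : last_before a b j v -> last_before a b j w -> v = w.
Proof.
move=> [bv vj maxv] [bw wj maxw].
have e : D a v = D a w by have := maxv _ bw wj; have := maxw _ bv vj; lra.
have [//|/eqP/D_gt0 ne] := eqVneq v w.
have bvw : between a v w by apply: between_le bw bv _; lra.
by exfalso; have := additive_btw aD bvw; lra.
Qed.

Lemma last_before_ex a b j : (0 <= j)%R -> exists v, last_before a b j v.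
Proof.
move=> j0; pose P i := (i <= len a b)%N && (D a (point a b i) <= j)%R.
have P0 : exists i, P i.
  exists 0%N; rewrite /P (@point_eq _ _ a b a 0) ?additivexx//; last exact: dist0.
  exact: btw_left.
have Ple i : P i -> (i <= len a b)%N by case/andP.
case: (ex_maxnP P0 Ple) => i /andP[le Di] maxi; have [bi di] := pointP le.
exists (point a b i); split=> // z bz zj.
have : (len a z <= len a (point a b i))%N.
  rewrite di; apply: maxi; rewrite /P (point_eq bz erefl) zj andbT.
  by move: bz; rewrite /btw; lia.
move=> /(btw_restrict bi bz)/(additive_btw aD) ->.
by have := D_ge0 z (point a b i); lra.
Qed.

(** A vertex strictly between [v] and [w] would have length at most [j], against the choice of [v],
    or more than [j], against that of [w]. *)
Lemma last_before_adj a b j v w :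
  last_before a b j v -> last_before b a (D a b - j)%R w -> v = w \/ aadj v w.
Proof.
move=> [bv vj maxv] [bw wj maxw].
have Db z : between a z b -> D b z = (D a b - D a z)%R.
  by move=> bz; rewrite (additive_btw aD bz) (additive_sym aD b z); lra.
have bw' := btw_sym bw; rewrite Db// in wj.
have bvw : between a v w by apply: between_le bw' bv _; lra.
case e : (len v w) => [|[|n]]; first by left; exact: dist_eq0 e.
  right; have [z zw vz] := dist_pred e; by rewrite (dist_eq0 vz).
have [z bz vz] : exists2 z, between v z w & len v z = 1%N by apply: btw_ex; rewrite e.
have bvz : between a v z.
  have := dist_triangle (atreeP T) z a w; have := dist_triangle (atreeP T) v a z.
  by move: bvw bz; rewrite /btw; lia.
have bazw : between a z w.
  by move: bvw bz bvz; rewrite /btw; lia.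
have baz : between a z b := btw_trans bw' bazw.
have /D_gt0 vnz : v <> z by move=> e'; move: vz; rewrite e' dist0.
have /D_gt0 znw : z <> w.
  by move=> e'; move: e; rewrite -e' vz.
exfalso; have := additive_btw aD bvz; have := additive_btw aD bazw.
have [le|lt] := Order.TotalTheory.leP (D a z) j; first by have := maxv _ baz le; lra.
by have := maxw _ (btw_sym baz); rewrite !Db//; lra.
Qed.

Lemma near_point_flip a b j v : near_point b a (D a b - j)%R v <-> near_point a b j v.
Proof.
rewrite /near_point (additive_sym aD b a).
have -> : (D a b - (D a b - j) = j)%R by lra.
by split=> -[]; [right|left|right|left].
Qed.

Lemma near_point_prefix a b m j v : between a m b -> (0 <= j <= D a m)%R ->
  near_point a b j v <-> near_point a m j v.
Proof.
move=> bm /andP[j0 jm].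
have Db z : between a z b -> D b z = (D a b - D a z)%R.
  by move=> bz; rewrite (additive_btw aD bz) (additive_sym aD b z); lra.
have Dm z : between a z m -> D m z = (D a m - D a z)%R.
  by move=> bz; rewrite (additive_btw aD bz) (additive_sym aD m z); lra.
have lo : last_before a b j v <-> last_before a m j v.
  split=> -[bv vj maxv].
    split=> // [|z bz zj]; first by apply: between_le bm bv _; lra.
    by apply: maxv => //; exact: btw_trans bm bz.
  split=> // [|z bz zj]; first exact: btw_trans bm bv.
  by apply: maxv => //; apply: between_le bm bz _; lra.
have up : last_before b a (D a b - j)%R v <-> last_before m a (D a m - j)%R v.
  split=> -[/btw_sym bv vj maxv].
    rewrite Db// in vj; have vm : (D a v <= D a m)%R.
      have := maxv _ (btw_sym bm); rewrite !Db//; lra.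
    have bvm := between_le bm bv vm; split=> [||z /btw_sym bz]; first exact: btw_sym.
      by rewrite Dm//; lra.
    have bz' := btw_trans bm bz; have := maxv _ (btw_sym bz').
    by rewrite !Db// !Dm//; lra.
  rewrite Dm// in vj; have bv' := btw_trans bm bv.
  split=> [||z /btw_sym bz]; first exact: btw_sym.
    by rewrite Db//; lra.
  rewrite !Db// => zj; case: (between_cases bm bz) => bmz.
    have := maxv _ (btw_sym bmz); rewrite !Dm//; lra.
  have := additive_btw aD bmz; have := D_ge0 m z; have := additive_btw aD bv.
  by have := D_ge0 v m; lra.
by rewrite /near_point lo up.
Qed.

(** The hypothesis bounds [j] by the Gromov product of [b] and [c] at [a], which is [D a m] for the
    median [m]; up to [m] the segments to [b] and [c] coincide. *)
Lemma near_point_tripod a b c j v : (0 <= j)%R -> (2 * j + D b c <= D a b + D a c)%R ->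
  near_point a b j v <-> near_point a c j v.
Proof.
move=> j0 jle; have [m [b1 b2 b3]] := median (atreeP T) a b c.
have jm : (0 <= j <= D a m)%R.
  rewrite j0 /=; move: jle; rewrite (additive_btw aD b1) (additive_btw aD b2).
  by rewrite (additive_btw aD b3) (additive_sym aD b m); lra.
by rewrite (near_point_prefix v b1 jm) (near_point_prefix v b2 jm).
Qed.

Lemma near_point_act g a b j v : near_point a b j v ->
  near_point (aact g a) (aact g b) j (aact g v).
Proof.
have lo x y i w : last_before x y i w -> last_before (aact g x) (aact g y) i (aact g w).
  move=> [bw wi maxw]; split; first exact/btw_act.
    by rewrite additive_act.
  move=> z; rewrite -{1 2}[z](aactKV g) => /btw_act bz; rewrite !additive_act// => zi.
  rewrite -[z](aactKV g) additive_act//; exact: maxw.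
by rewrite /near_point additive_act// => -[/lo|/lo]; [left|right].
Qed.

Lemma near_point_pair a b j : (0 <= j <= D a b)%R ->
  exists v w, [/\ near_point a b j v, near_point a b j w, v = w \/ aadj v w &
    forall z, near_point a b j z -> z = v \/ z = w].
Proof.
move=> /andP[j0 jab]; have [v lv] := last_before_ex a b j0.
have [|w lw] := @last_before_ex b a (D a b - j)%R; first lra.
exists v, w; split; [by left|by right|exact: last_before_adj lv lw|].
by move=> z [/last_before_uniq/(_ lv)|/last_before_uniq/(_ lw)] ->; [left|right].
Qed.

End LengthPoint.

Section Transfer.
Variables (G : groupType) (X : gcomplex G) (T : atree G) (f : X -> T).
Hypothesis f_act : forall g x, f (cact g x) = aact g (f x).
Variables (W : atree G) (h : X -> W).
Hypothesis h_act : forall g x, h (cact g x) = aact g (h x).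

Let S := resolution f_act.
Variables (D : S -> S -> rat) (E : W -> W -> rat).
Hypotheses (aD : additive D) (D_ge0 : forall c d, (0 <= D c d)%R).
Hypotheses (aE : additive E) (E_gt0 : forall a b, a <> b -> (0 < E a b)%R).
Hypothesis DE : forall x y, cE x y -> E (h x) (h y) = D (star f_act x) (star f_act y).

(** The stabilizer of [c] preserves a set consisting of one vertex or of the two ends of an edge of
    [W], and there are no inversions. *)
Lemma resolution_vertex_elliptic (c : S) :
  exists w : W, forall g, aact g c = c -> aact g w = w.
Proof.
elim/rvertex_ind: c => x0 y0 v k0.
(* The vertices of [W] near the point whose length along the image of [xy] is that of the point over
   [v] in the resolution. This set is shown to be the same for all edges [xy] through [c]. *)
pose F x y := [set w | exists k : on f v x y,
  near_point E (h x) (h y) (D (star f_act x) (rpoint k)) w].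
have Dflip x y (k : on f v x y) : D (star f_act y) (rpoint k) =
    (E (h x) (h y) - D (star f_act x) (rpoint k))%R.
  rewrite DE; last exact: k.1.
  rewrite (additive_btw aD (between_stars f_act k)) (additive_sym aD (star f_act y)); lra.
have F_chain x y : chain (on f v) x0 y0 x y -> F x0 y0 = F x y.
  apply: (chain_invariant _ k0) => {x y} [x y|x y k|x y z kxy kxz yz].
  - exact: on_sym.
  - have flip a b : F a b `<=` F b a.
      move=> w [ka nw]; exists (on_sym ka); rewrite -rpoint_flip Dflip.
      exact/near_point_flip.
    by rewrite eqEsubset; split; exact: flip.
  - have slide a b b' : cE b b' -> on f v a b' -> F a b `<=` F a b'.
      move=> bb' kb' w [kb nw]; exists kb'.
      have e : rpoint kb' = rpoint kb.
        apply/rpoint_eqP; split=> //; apply: (chain_slide (chain_refl _ _ _) kb' kb).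
        exact: cE_sym.
      (* The vertex [rpoint kb] lies on the segments from [star a] to both [star b] and [star b'],
         so the triangle inequality in the resolution gives the bound on the Gromov product, which
         transfers to [W] through [DE]. *)
      rewrite e; apply: (near_point_tripod aE E_gt0 w _ _).1 nw => //.
      rewrite (DE bb') (DE kb.1) (DE kb'.1).
      rewrite (additive_btw aD (between_stars f_act kb)).
      rewrite (additive_btw aD (between_stars f_act kb')) e.
      have := additive_triangle aD D_ge0 (star f_act b) (rpoint kb) (star f_act b').
      by rewrite (additive_sym aD (star f_act b) (rpoint kb)); lra.
    by rewrite eqEsubset; split; apply: slide => //; exact: cE_sym.
set c := rpoint k0; set j := D (star f_act x0) c.
have [] := @near_point_pair _ _ E aE E_gt0 (h x0) (h y0) j.
  rewrite D_ge0 (DE k0.1) (additive_btw aD (between_stars f_act k0)).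
  by have := D_ge0 c (star f_act y0); rewrite -/c -/j; lra.
move=> w0 [w1 [n0 n1 w01 only]]; exists w0 => g gc.
have stable w : near_point E (h x0) (h y0) j w -> aact g w = w0 \/ aact g w = w1.
  move=> nw; apply: only.
  have [gv _] : aact g v = v /\ True.
    by split=> //; have := congr1 (@rproj _ _ _ f) gc; rewrite rproj_aact !rproj_point.
  have k1 : on f v (cact g x0) (cact g y0) by rewrite -gv; exact: on_act.
  have e1 : rpoint k1 = c by rewrite -gc /aact/= ract_point; exact: rpoint_congr.
  have ch : chain (on f v) x0 y0 (cact g x0) (cact g y0).
    by have /rpoint_eqP[_ /chain_sym] := e1.
  have : F x0 y0 (aact g w).
    rewrite (F_chain _ _ ch); exists k1; rewrite !h_act e1 -gc star_act additive_act//.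
    exact: near_point_act.
  by move=> [k]; rewrite (Prop_irrelevance k k0).
exact: fix_close_pair w01 (stable _ n0) (stable _ n1).
Qed.

End Transfer.

(** * The complex of a relative presentation *)

Lemma pres_gen_ind (X : choiceType) (R : set (seq (X * bool))) (P : pres R -> Prop) :
  P 1 -> (forall u v, P u -> P v -> P (u * v)) -> (forall u, P u -> P u^-1) ->
  (forall x, P (pres_gen R x)) -> forall u, P u.
Proof.
move=> P1 PM PV Pgen; elim/word_class_ind; elim=> [|[x b] w IH]; first exact: P1.
have -> : word_class R ((x, b) :: w) = word_class R [:: (x, b)] * word_class R w.
  by rewrite [RHS]pres_mulE.
apply: PM => //; case: b; last exact: Pgen.
suff -> : word_class R [:: (x, true)] = (pres_gen R x)^-1 by exact: PV.
have e : pres_gen R x * word_class R [:: (x, true)] = 1.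
  rewrite [LHS]pres_mulE; apply/pres_eqP; exact: (word_eqv_cancel R [::] [::] x false).
by rewrite -[LHS](mulKg (pres_gen R x)) e mulg1.
Qed.

Section Cosets.
Variables (G : groupType) (p : nat) (H : 'I_p -> subgroup G).
Implicit Types (a b g h : G) (i : 'I_p).

(* The element [a] of G is represented by the vertex [[set a]], so that the cosets
   of a trivial [H i] yield no further vertices. *)
Definition is_coset (x : set G) : bool :=
  `[< (exists a, x = [set a]) \/ exists i a, x = [set b | H i (a^-1 * b)] >].

Definition coset_vertex : choiceType := {x : set G | is_coset x}.

Lemma singleton_subproof a : is_coset [set a].
Proof. by apply/asboolP; left; exists a. Qed.

Definition singleton a : coset_vertex := exist is_coset _ (singleton_subproof a).

Lemma coset_subproof i a : is_coset [set b | H i (a^-1 * b)].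
Proof. by apply/asboolP; right; exists i, a. Qed.

Definition coset i a : coset_vertex := exist is_coset _ (coset_subproof i a).

Lemma coset_vertex_ind (P : coset_vertex -> Prop) :
  (forall a, P (singleton a)) -> (forall i a, P (coset i a)) -> forall x, P x.
Proof.
move=> Ps Pc [x hx]; have /asboolP[[a e]|[i [a e]]] := hx.
  by have -> : exist is_coset x hx = singleton a by exact: val_inj.
by have -> : exist is_coset x hx = coset i a by exact: val_inj.
Qed.

Lemma singleton_inj : injective singleton.
Proof. by move=> a b /(congr1 val)/= e; have : [set a] a by []; rewrite e. Qed.

Lemma coset_eq i a h : H i h -> coset i (a * h) = coset i a.
Proof.
move=> Hh; apply: val_inj; rewrite /= predeqE => b /=; rewrite invgM -mulgA; split=> Hb.
  by rewrite -[_ * b](mulVKg h); apply: subgroupM.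
by apply: subgroupM => //; exact: subgroupV.
Qed.

Lemma mem_coset i a b : val (coset i a) b -> exists2 h, H i h & b = a * h.
Proof. by exists (a^-1 * b) => //; rewrite mulgA mulgV mul1g. Qed.

Lemma coset_self i a : val (coset i a) a.
Proof. by rewrite /= mulVg; exact: subgroup1. Qed.

Lemma coset_act_subproof g (x : coset_vertex) : is_coset [set b | val x (g^-1 * b)].
Proof.
elim/coset_vertex_ind: x => [a|i a]; apply/asboolP; [left; exists (g * a)|right; exists i, (g * a)].
  rewrite predeqE => b /=; split=> [<-|->]; by rewrite mulgA ?mulgV ?mulVg mul1g.
by rewrite predeqE => b /=; rewrite invgM mulgA.
Qed.

Definition coset_act g x : coset_vertex := exist is_coset _ (coset_act_subproof g x).

Lemma coset_act_singleton g a : coset_act g (singleton a) = singleton (g * a).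
Proof.
apply: val_inj; rewrite /= predeqE => b /=.
by split=> [<-|->]; rewrite mulgA ?mulgV ?mulVg mul1g.
Qed.

Lemma coset_act_coset g i a : coset_act g (coset i a) = coset i (g * a).
Proof. by apply: val_inj; rewrite /= predeqE => b /=; rewrite invgM mulgA. Qed.

Lemma coset_act1 x : coset_act 1 x = x.
Proof.
by elim/coset_vertex_ind: x => *; rewrite ?coset_act_singleton ?coset_act_coset mul1g.
Qed.

Lemma coset_actM g h x : coset_act (g * h) x = coset_act g (coset_act h x).
Proof.
by elim/coset_vertex_ind: x => *; rewrite ?coset_act_singleton ?coset_act_coset mulgA.
Qed.

Lemma coset_fixed i h : H i h -> coset_act h (coset i 1) = coset i 1.
Proof. by move=> Hh; rewrite coset_act_coset mulg1 -[h]mul1g coset_eq. Qed.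

(** The stabilizer of a singleton is trivial, and that of the coset of [a] is the conjugate of [H i]
    by [a], which fixes the translate by [a] of a point fixed by [H i]. *)
Lemma coset_equivariant_map (T : atree G) :
  (forall i, exists t : T, forall h, H i h -> aact h t = t) ->
  exists f : coset_vertex -> T, forall g x, f (coset_act g x) = aact g (f x).
Proof.
move=> fixH; have [t0 _] := tree_nonempty (atreeP T).
have [||f fP] := @equivariant_choice G coset_vertex T coset_act (@aact _ T) (fun=> True) t0
  coset_act1 coset_actM (@aact1 _ T) (@aactM _ T); last by exists f => g x; exact: fP.
  by [].
elim/coset_vertex_ind=> [a|i a] _.
  exists t0 => g; rewrite coset_act_singleton => /singleton_inj e.
  have -> : g = 1 by rewrite -[g](mulgK a) e mulgV.
  exact: aact1.
have [t tP] := fixH i; exists (aact a t) => g; rewrite coset_act_coset => e.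
have /mem_coset[h Hh e'] : val (coset i a) (g * a) by rewrite -e; exact: coset_self.
by rewrite -aactM e' aactM tP.
Qed.

Variable B : set G.
Hypotheses (finB : finite_set B) (BV : forall b, B b -> B b^-1).

(** The edges of a Cayley graph for [B], and edges coning off each coset of an [H i]; equality makes
    the relation reflexive, as [gcomplex] requires. *)
Definition coset_adj (x y : coset_vertex) := [\/ x = y,
  exists a b, [/\ B b, x = singleton a & y = singleton (a * b)],
  exists i a, x = singleton a /\ y = coset i a |
  exists i a, x = coset i a /\ y = singleton a].

Lemma coset_adj_refl x : coset_adj x x.
Proof. by constructor 1. Qed.

Lemma coset_adj_sym x y : coset_adj x y -> coset_adj y x.
Proof.
case=> [->|[a [b [Bb -> ->]]]|[i [a [-> ->]]]|[i [a [-> ->]]]].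
- by constructor 1.
- by constructor 2; exists (a * b), b^-1; rewrite mulgK; split=> //; exact: BV.
- by constructor 4; exists i, a.
- by constructor 3; exists i, a.
Qed.

Lemma coset_adj_act g x y : coset_adj x y -> coset_adj (coset_act g x) (coset_act g y).
Proof.
case=> [->|[a [b [Bb -> ->]]]|[i [a [-> ->]]]|[i [a [-> ->]]]].
- by constructor 1.
- by constructor 2; exists (g * a), b; rewrite !coset_act_singleton mulgA.
- by constructor 3; exists i, (g * a); rewrite coset_act_singleton coset_act_coset.
- by constructor 4; exists i, (g * a); rewrite coset_act_singleton coset_act_coset.
Qed.

Lemma coset_adj_singleton x y : coset_adj x y -> x <> y ->
  exists a, x = singleton a \/ y = singleton a.
Proof.
case=> [//|[a [b [Bb -> ->]]]|[i [a [-> ->]]]|[i [a [-> ->]]]] _; exists a; by [left|right].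
Qed.

Lemma coset_adj_free g x y : coset_adj x y -> x <> y ->
  coset_act g x = x -> coset_act g y = y -> g = 1.
Proof.
move=> xy /(coset_adj_singleton xy)[a [->|->]].
  by rewrite coset_act_singleton => /singleton_inj e _; rewrite -[g](mulgK a) e mulgV.
by rewrite coset_act_singleton => _ /singleton_inj e; rewrite -[g](mulgK a) e mulgV.
Qed.

Lemma finite_singleton_nbrs a : finite_set [set z | coset_adj (singleton a) z].
Proof.
apply: (@sub_finite_set _ _ ([set singleton a] `|` (fun b => singleton (a * b)) @` B `|`
  (fun i => coset i a) @` [set: 'I_p])).
  move=> z /= [<-|[a' [b [Bb /singleton_inj <- ->]]]|[i [a' [/singleton_inj <- ->]]]|
    [i [a' [/(congr1 val)/= e ->]]]].
  - by left; left.
  - by left; right; exists b.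
  - by right; exists i.
  (* For trivial [H i], the vertex [coset i a'] coincides with [singleton a]; then [a' = a] and the
     neighbour is [singleton a] itself. *)
  - left; left; have : [set a] a' by rewrite e /= mulVg; exact: subgroup1.
    by move=> ->.
rewrite !finite_setU; split; first by split; [exact: finite_set1|exact: finite_image].
by apply: finite_image; exact: finite_finset.
Qed.

Lemma coset_adj_finite_link x y : coset_adj x y -> x <> y ->
  finite_set [set z | coset_adj x z /\ coset_adj y z].
Proof.
move=> xy /(coset_adj_singleton xy)[a [->|->]];
  by apply: sub_finite_set (finite_singleton_nbrs a) => z [].
Qed.

Lemma coset_adj_cofinite : exists m (u v : 'I_m -> coset_vertex),
  (forall k, coset_adj (u k) (v k)) /\ forall x y, coset_adj x y ->
  exists k g, x = coset_act g (u k) /\ y = coset_act g (v k).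
Proof.
pose A : set (coset_vertex * coset_vertex) := [set s | coset_adj s.1 s.2 /\
  ((singleton 1 |` (coset^~ 1 @` [set: 'I_p])) `*`
   (singleton 1 |` (coset^~ 1 @` [set: 'I_p]) `|` (singleton @` B))) s].
have finC : finite_set (coset^~ 1 @` [set: 'I_p]) by apply: finite_image; exact: finite_finset.
have : finite_set A.
  apply: (@sub_finite_set _ _ ((singleton 1 |` (coset^~ 1 @` [set: 'I_p])) `*`
     (singleton 1 |` (coset^~ 1 @` [set: 'I_p]) `|` (singleton @` B)))); first by move=> s [].
  apply: finite_setX; rewrite !finite_setU; do ?split=> //; try exact: finite_set1.
  exact: finite_image.
move=> /finite_seqP[s As].
have As' k : (k < size s)%N -> A (nth (singleton 1, singleton 1) s k).
  by move=> ks; rewrite As; exact: mem_nth.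
exists (size s), (fun k => (nth (singleton 1, singleton 1) s k).1),
  (fun k => (nth (singleton 1, singleton 1) s k).2); split.
  by move=> k; have [] := As' _ (ltn_ord k).
move=> x y xy; suff [g [t At [xt yt]]] : exists g, exists2 t, A t &
    x = coset_act g t.1 /\ y = coset_act g t.2.
  move: At; rewrite As /= => ts; have it : (index t s < size s)%N by rewrite index_mem.
  by exists (Ordinal it), g; rewrite /= nth_index.
have mk g t1 t2 : x = coset_act g t1 -> y = coset_act g t2 ->
   ((singleton 1 |` (coset^~ 1 @` [set: 'I_p])) `*`
   (singleton 1 |` (coset^~ 1 @` [set: 'I_p]) `|` (singleton @` B))) (t1, t2) ->
   exists g, exists2 t, A t & x = coset_act g t.1 /\ y = coset_act g t.2.
  move=> xt yt tt; exists g, (t1, t2) => //; split=> //=.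
  by have := coset_adj_act g^-1 xy; rewrite xt yt -!coset_actM mulVg !coset_act1.
have s1 a : singleton a = coset_act a (singleton 1) by rewrite coset_act_singleton mulg1.
have c1 i a : coset i a = coset_act a (coset i 1) by rewrite coset_act_coset mulg1.
have inC i : (coset^~ 1 @` [set: 'I_p]) (coset i 1) by exists i.
case: xy => [<-{y mk}|[a [b [Bb xa ya]]]|[i [a [xa ya]]]|[i [a [xa ya]]]]; last 3 first.
- apply: (mk a (singleton 1) (singleton b)); rewrite -?s1// ?coset_act_singleton//.
  by split; [left|right; exists b].
- by apply: (mk a (singleton 1) (coset i 1)); rewrite -?s1// -?c1//; split; [left|left; right].
- by apply: (mk a (coset i 1) (singleton 1)); rewrite -?s1// -?c1//; split; [right|left; left].
elim/coset_vertex_ind: x => [a|i a].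
  exists a, (singleton 1, singleton 1); rewrite -?s1//; split; first exact: coset_adj_refl.
  by split; [left|left; left].
exists a, (coset i 1, coset i 1); rewrite -?c1//; split; first exact: coset_adj_refl.
by split; [right|left; right].
Qed.

End Cosets.

(* The semidirect product of G with the functions G -> Z/2, used to integrate a
   cocycle along words. *)
Section Wreath.
Variable G : groupType.

Definition wreath : Type := (G * (G -> bool))%type.

HB.instance Definition _ := Choice.on wreath.

Definition wreath1 : wreath := (1, fun=> false).
(** The second component at [x] is meant as the integral along a path from [x] to [x * a.1]; the
    product concatenates paths. *)
Definition wreath_mul (a b : wreath) : wreath :=
  (a.1 * b.1, fun x => a.2 x (+) b.2 (x * a.1)).
Definition wreath_inv (a : wreath) : wreath := (a.1^-1, fun x => a.2 (x * a.1^-1)).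

Lemma wreath_mulA : associative wreath_mul.
Proof.
move=> a b c; rewrite /wreath_mul /= mulgA; congr pair; apply: funext => x.
by rewrite mulgA addbA.
Qed.

Lemma wreath_mul1 : left_id wreath1 wreath_mul.
Proof.
by move=> [a f]; rewrite /wreath_mul /= mul1g; congr pair; apply: funext => x; rewrite mulg1.
Qed.

Lemma wreath_1mul : right_id wreath1 wreath_mul.
Proof.
by move=> [a f]; rewrite /wreath_mul /= mulg1; congr pair; apply: funext => x; rewrite addbF.
Qed.

Lemma wreath_mulV : right_inverse wreath1 wreath_inv wreath_mul.
Proof.
move=> [a f]; rewrite /wreath_mul /= mulgV; congr pair; apply: funext => x.
by rewrite mulgK addbb.
Qed.

Lemma wreath_Vmul : left_inverse wreath1 wreath_inv wreath_mul.
Proof.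
move=> [a f]; rewrite /wreath_mul /= mulVg; congr pair; apply: funext => x.
by rewrite addbb.
Qed.

HB.instance Definition _ := isGroup.Build wreath
  wreath_mulA wreath_mul1 wreath_1mul wreath_Vmul wreath_mulV.

End Wreath.

Lemma group_morph1 (A B : groupType) (f : A -> B) : {morph f : x y / x * y} -> f 1 = 1.
Proof. by move=> fM; rewrite -[LHS](mulKg (f 1)) -fM mul1g mulVg. Qed.

Lemma group_morphV (A B : groupType) (f : A -> B) :
  {morph f : x y / x * y} -> {morph f : x / x^-1}.
Proof.
by move=> fM x; rewrite -[LHS](mulKg (f x)) -fM mulgV (group_morph1 fM) mulg1.
Qed.

(** * Integrals of a cocycle along the words of the free product *)

Section Integration.
Variables (G : groupType) (Omega : set G) (p : nat) (H : 'I_p -> subgroup G).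
Implicit Types (a b g : G) (i : 'I_p).

Notation F := (freeprod (rel_factor Omega H)).
Notation rmap := (@rel_map G Omega p H).

Definition free_letter (w : Omega) : F :=
  @freeprod_in _ (rel_factor Omega H) None (pres_gen set0 w).

Definition factor_letter i (h : subgroup_sort (H i)) : F :=
  @freeprod_in _ (rel_factor Omega H) (Some i) h.

Lemma rel_mapM : {morph rmap : u v / u * v}.
Proof. exact: freeprod_liftM. Qed.

Lemma rel_map_free w : rmap (free_letter w) = val w.
Proof. by rewrite /rel_map freeprod_lift_in /= freegroup_lift_gen. Qed.

Lemma rel_map_factor i (h : subgroup_sort (H i)) : rmap (factor_letter h) = val h.
Proof. by rewrite /rel_map freeprod_lift_in. Qed.

Lemma rel_factor_ind (P : F -> Prop) :
  P 1 -> (forall u v, P u -> P v -> P (u * v)) -> (forall u, P u -> P u^-1) ->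
  (forall w, P (free_letter w)) -> (forall i h, P (@factor_letter i h)) -> forall u, P u.
Proof.
move=> P1 PM PV Pfree Pfac; apply: pres_gen_ind => // -[[i|] k]; first exact: Pfac.
pose in0 := @freeprod_in _ (rel_factor Omega H) None.
have in0M : {morph in0 : x y / x * y} by exact: freeprod_inM.
change (P (in0 k)); move: k; apply: pres_gen_ind => [|u v Pu Pv|u Pu|w].
- by rewrite (group_morph1 in0M).
- by rewrite in0M; exact: PM.
- by rewrite (group_morphV in0M); exact: PV.
- exact: Pfree.
Qed.

Section Cochain.
Variable d : coset_vertex H -> coset_vertex H -> bool.

Notation pt := (@singleton G p H).
Notation cs := (@coset G p H).

Definition integral_free (w : Omega) : wreath G :=
  (val w, fun x => d (pt x) (pt (x * val w))).

(** The path from [x] to [x * val h] goes through the coset they share, so it exists for every [h],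
    not only for those in [B], and it makes the integral multiplicative on the factor. *)
Definition integral_factor i (h : subgroup_sort (H i)) : wreath G :=
  (val h, fun x => d (pt x) (cs i x) (+) d (pt (x * val h)) (cs i x)).

Lemma integral_factorM i : {morph @integral_factor i : h k / h * k}.
Proof.
move=> h k; rewrite /integral_factor; congr pair; apply: funext => x /=.
have -> : cs i (x * val h) = cs i x by apply: coset_eq; exact/set_mem/(valP h).
by rewrite mulgA addbA -(addbA (d (pt x) _)) addbb addbF.
Qed.

HB.instance Definition _ i :=
  isMultiplicative.Build _ _ (@integral_factor i) (@integral_factorM i).

Definition integral_map (o : option 'I_p) : {multiplicative rel_factor Omega H o -> wreath G} :=
  match o return {multiplicative rel_factor Omega H o -> wreath G} with
  | Some i => @integral_factor i
  | None => freegroup_lift integral_free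
  end.

Definition integral : F -> wreath G := freeprod_lift integral_map.

Lemma integralM : {morph integral : u v / u * v}.
Proof. exact: freeprod_liftM. Qed.

Lemma integral_free_letter w : integral (free_letter w) = integral_free w.
Proof. by rewrite /integral freeprod_lift_in /= freegroup_lift_gen. Qed.

Lemma integral_factor_letter i (h : subgroup_sort (H i)) :
  integral (factor_letter h) = integral_factor h.
Proof. by rewrite /integral freeprod_lift_in. Qed.

Lemma integral_rel_map u : (integral u).1 = rmap u.
Proof.
elim/rel_factor_ind: u => [|u v IHu IHv|u IHu|w|i h].
- by rewrite (group_morph1 integralM) (group_morph1 rel_mapM).
- by rewrite integralM rel_mapM -IHu -IHv.
- by rewrite (group_morphV integralM) (group_morphV rel_mapM) -IHu.
- by rewrite integral_free_letter rel_map_free.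
- by rewrite integral_factor_letter rel_map_factor.
Qed.

Variable B : set G.
Hypothesis BV : forall b, B b -> B b^-1.

Notation E := (@coset_adj G p H B).

Hypothesis d_cocycle : forall x y z, E x y -> E y z -> E x z -> d x z = d x y (+) d y z.

Lemma cocycle_refl x : d x x = false.
Proof.
have r : E x x by exact: coset_adj_refl.
by have := d_cocycle r r r; case: (d x x).
Qed.

Lemma cocycle_sym x y : E x y -> d x y = d y x.
Proof.
move=> xy; have := d_cocycle xy (coset_adj_sym BV xy) (coset_adj_refl _ _).
by rewrite cocycle_refl; case: (d x y) (d y x) => [] [].
Qed.

Lemma adj_translate x b : B b -> E (pt x) (pt (x * b)).
Proof. by constructor 2; exists x, b. Qed.

Lemma adj_coset i x : E (pt x) (cs i x).
Proof. by constructor 3; exists i, x. Qed.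

(* The integral of [d] along [u] only depends on the ends of the path [u]. *)
Definition exact_along u := forall x, (integral u).2 x = d (pt x) (pt (x * rmap u)).

Lemma exact_along1 : exact_along 1.
Proof. by move=> x; rewrite (group_morph1 integralM) (group_morph1 rel_mapM) mulg1 cocycle_refl. Qed.

Lemma exact_alongM u v : B (rmap u) -> B (rmap v) -> B (rmap (u * v)) ->
  exact_along u -> exact_along v -> exact_along (u * v).
Proof.
move=> Bu Bv Buv eu ev x; rewrite integralM /= eu ev integral_rel_map rel_mapM mulgA.
rewrite (@d_cocycle (pt x) (pt (x * rmap u)) (pt (x * rmap u * rmap v)))//; try exact: adj_translate.
by rewrite -mulgA -rel_mapM; exact: adj_translate.
Qed.

Lemma exact_alongV u : B (rmap u) -> exact_along u -> exact_along u^-1.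
Proof.
move=> Bu eu x; rewrite (group_morphV integralM) /= eu integral_rel_map mulgVK.
rewrite (group_morphV rel_mapM) cocycle_sym//.
have := adj_translate (x * (rmap u)^-1) Bu; by rewrite mulgVK.
Qed.

Lemma exact_along_free w : exact_along (free_letter w).
Proof. by move=> x; rewrite integral_free_letter rel_map_free. Qed.

Lemma exact_along_factor i (h : subgroup_sort (H i)) : B (val h) ->
  exact_along (factor_letter h).
Proof.
move=> Bh x; rewrite integral_factor_letter rel_map_factor /=.
have e : cs i (x * val h) = cs i x by apply: coset_eq; exact/set_mem/(valP h).
have hc : E (pt (x * val h)) (cs i x) by rewrite -e; exact: adj_coset.
rewrite (@d_cocycle (pt x) (cs i x) (pt (x * val h)))//; first by rewrite (cocycle_sym hc).
- exact: adj_coset.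
- exact: coset_adj_sym.
- exact: adj_translate.
Qed.

End Cochain.

(* Every word is accounted for by finitely many translations, those by its prefixes. *)
Lemma exact_along_finite u : exists L : set F, [/\ finite_set L, L u &
  forall B (d : coset_vertex H -> coset_vertex H -> bool), (forall b, B b -> B b^-1) ->
    (forall x y z, coset_adj B x y -> coset_adj B y z -> coset_adj B x z ->
      d x z = d x y (+) d y z) ->
    (forall v, L v -> B (rmap v)) -> forall v, L v -> exact_along d v].
Proof.
elim/rel_factor_ind: u => [|u v [L [finL Lu LP]] [M [finM Mv MP]]|u [L [finL Lu LP]]|w|i h].
- exists [set 1]; split=> //.
  by move=> B d BV dc _ v ->; exact: (exact_along1 dc).
- exists (u * v |` (L `|` M)); split; last 2 first.
  + by left.
  + move=> B d BV dc LMB.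
    have eL w (Lw : L w) : exact_along d w.
      by apply: (LP B) => // w' Lw'; apply: LMB; right; left.
    have eM w (Mw : M w) : exact_along d w.
      by apply: (MP B) => // w' Mw'; apply: LMB; right; right.
    move=> w [->|[/eL|/eM]]//; apply: (exact_alongM dc); [..|exact: eL|exact: eM].
    * by apply: LMB; right; left.
    * by apply: LMB; right; right.
    * by apply: LMB; left.
  + by rewrite !finite_setU; split; [exact: finite_set1|].
- exists (u^-1 |` L); split; last 2 first.
  + by left.
  + move=> B d BV dc LB.
    have eL w (Lw : L w) : exact_along d w.
      by apply: (LP B) => // w' Lw'; apply: LB; right.
    move=> w [->|/eL]//; apply: (exact_alongV BV dc); last exact: eL.
    by apply: LB; right.
  + by rewrite finite_setU; split; [exact: finite_set1|].
- exists [set free_letter w]; split=> //.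
  by move=> B d BV dc _ v ->; exact: exact_along_free.
- exists [set factor_letter h]; split=> //.
  move=> B d BV dc LB v ->; apply: (exact_along_factor BV dc).
  by rewrite -(rel_map_factor h); exact: LB.
Qed.

End Integration.

(** * Cohomology and connectedness of the coset complex *)

Section CosetComplex.
Variables (G : groupType) (Omega : set G) (p : nat) (H : 'I_p -> subgroup G).
Hypotheses (finO : finite_set Omega) (ontoO : forall g : G, exists u, rel_map Omega H u = g).
Variables (R : set (freeprod (rel_factor Omega H))).
Hypotheses (finR : finite_set R) (kerR : ker (rel_map Omega H) = normal_closure R).

Notation F := (freeprod (rel_factor Omega H)).
Notation rmap := (@rel_map G Omega p H).
Notation pt := (@singleton G p H).
Notation cs := (@coset G p H).

Lemma ker_subgroup_subproof d : group_closed (mem (ker (@integral G Omega p H d))).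
Proof.
have iM := @integralM G Omega p H d.
split; first by apply/mem_set; exact: (group_morph1 iM).
move=> u v /set_mem iu /set_mem iv; apply/mem_set.
by rewrite /ker /= iM (group_morphV iM) iu iv invg1 mulg1.
Qed.

(** With [B] large enough to triangulate every relator, the integral of a cocycle vanishes on the
    relators, hence depends only on the element of [G] reached; it is then a primitive of [d]. *)
Lemma coset_coboundary : exists B : set G, [/\ finite_set B, forall b, B b -> B b^-1,
  forall w : Omega, B (val w) &
  forall d : coset_vertex H -> coset_vertex H -> bool,
    (forall x y z, coset_adj B x y -> coset_adj B y z -> coset_adj B x z ->
      d x z = d x y (+) d y z) ->
    exists s : coset_vertex H -> bool, forall x y, coset_adj B x y -> d x y = s x (+) s y].
Proof.
pose L u := projT1 (cid (@exact_along_finite G Omega p H u)).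
have LP u : [/\ finite_set (L u), L u u & forall B d, (forall b, B b -> B b^-1) ->
    (forall x y z, coset_adj B x y -> coset_adj B y z -> coset_adj B x z ->
      d x z = d x y (+) d y z) ->
    (forall v, L u v -> B (rmap v)) -> forall v, L u v -> exact_along d v].
  exact: projT2 (cid (@exact_along_finite G Omega p H u)).
pose A := \bigcup_(r in R) L r `|` (@free_letter G Omega p H) @` [set: Omega].
have finA : finite_set A.
  rewrite finite_setU; split; first by apply: bigcup_finite => // r _; have [] := LP r.
  apply: finite_image; apply: (@sub_finite_set _ _ (val @^-1` Omega)).
    by move=> w _; exact/set_mem/(valP w).
  by apply: finite_preimage finO; apply: in2W; exact: val_inj.
(* The images of all the subwords needed for the relators and of the letters from [Omega], closed
   under inversion. *)
pose B := rmap @` A `|` (fun u => (rmap u)^-1) @` A.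
have BA u : A u -> B (rmap u) by move=> Au; left; exists u.
have BV b : B b -> B b^-1.
  by case=> [[u Au <-]|[u Au <-]]; [right|left]; exists u; rewrite ?invgK.
exists B; split=> //.
- by rewrite finite_setU; split; exact: finite_image.
- by move=> w; rewrite -(rel_map_free H w); apply: BA; right; exists w.
move=> d dc.
have eA u : A u -> exact_along d u.
  move=> [[r Rr Lu]|[w _ <-]]; last exact: exact_along_free.
  have [_ _ /(_ B d BV dc)] := LP r; apply=> // v Lv; apply: BA; left; by exists r.
have iM := @integralM G Omega p H d; have rM := @rel_mapM G Omega p H.
have R1 r : R r -> rmap r = 1.
  move=> Rr; have : ker (@rel_map G Omega p H) r by rewrite kerR => N _; apply.
  by [].
have iR r : R r -> integral d r = 1.
  move=> Rr; have er : exact_along d r.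
    by apply: eA; left; exists r => //; have [] := LP r.
  rewrite [LHS]surjective_pairing integral_rel_map (R1 r Rr); congr pair; apply: funext => x.
  by rewrite er (R1 r Rr) mulg1 (cocycle_refl dc).
(* The kernel of [integral d] is normal and contains [R], hence contains the kernel of the map to
   [G]. *)
have iker u : rmap u = 1 -> integral d u = 1.
  move=> u1; have : ker (@rel_map G Omega p H) u by [].
  rewrite kerR => /(_ (Subgroup (ker_subgroup_subproof d))); apply; last exact: iR.
  move=> x g; rewrite /= /ker /= => x1.
  by rewrite conjgE !iM x1 mul1g -iM mulVg (group_morph1 iM).
pose lift g : F := projT1 (cid (ontoO g)).
have liftK g : rmap (lift g) = g by exact: projT2 (cid (ontoO g)).
pose s1 g := (integral d (lift g)).2 1.
have s1E u : (integral d u).2 1 = s1 (rmap u).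
  have e : integral d (u * (lift (rmap u))^-1) = 1.
    by apply: iker; rewrite rM (group_morphV rM) liftK mulgV.
  by rewrite -[in LHS](mulgVK (lift (rmap u)) u) iM e mul1g.
have s1M g v : s1 (g * rmap v) = s1 g (+) (integral d v).2 g.
  by rewrite -{1}(liftK g) -rM -s1E iM /= integral_rel_map liftK mul1g.
(* The value at a coset is obtained from one of its elements; [s_cs] shows that any other element
   gives the same value. *)
pose s x := s1 (xget 1 (val x)) (+) d (pt (xget 1 (val x))) x.
have s_pt a : s (pt a) = s1 a.
  rewrite /s; have -> : xget 1 (val (pt a)) = a.
    by apply: (@xgetPex _ 1 [set a]); exists a.
  by rewrite (cocycle_refl dc) addbF.
have s_cs i a : s (cs i a) = s1 a (+) d (pt a) (cs i a).
  rewrite /s; have : val (cs i a) (xget 1 (val (cs i a))).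
    by apply: xgetPex; exists a; exact: coset_self.
  move: (xget _ _) => b /mem_coset[h Hh ->].
  pose h' : subgroup_sort (H i) := exist _ h (mem_set Hh).
  have -> : a * h = a * rmap (factor_letter Omega h') by rewrite rel_map_factor.
  rewrite s1M integral_factor_letter rel_map_factor /=.
  by rewrite -!addbA addbb addbF.
exists s => x y; case=> [->|[a [b [Bb -> ->]]]|[i [a [-> ->]]]|[i [a [-> ->]]]].
- by rewrite addbb (cocycle_refl dc).
- rewrite !s_pt; have [v -> ev] : exists2 v, b = rmap v & exact_along d v.
    case: Bb => -[u Au <-]; first by exists u => //; exact: eA.
    exists u^-1; first by rewrite (group_morphV rM).
    by apply: (exact_alongV BV dc); [exact: BA|exact: eA].
  by rewrite s1M addbA addbb ev.
- by rewrite s_pt s_cs addbA addbb.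
- rewrite (cocycle_sym BV dc); last by constructor 4; exists i, a.
  by rewrite s_pt s_cs addbC addbA addbb.
Qed.

Lemma coset_connected (B : set G) : (forall w : Omega, B (val w)) -> (forall b, B b -> B b^-1) ->
  forall P : coset_vertex H -> Prop, (forall x y, coset_adj B x y -> P x -> P y) ->
  forall x y, P x -> P y.
Proof.
move=> OB BV P PE.
have PEE x y : coset_adj B x y -> P x <-> P y.
  by move=> xy; split; apply: PE => //; exact: coset_adj_sym.
have Pcs i a : P (cs i a) <-> P (pt a) by apply: PEE; constructor 4; exists i, a.
have step u : forall a, P (pt a) <-> P (pt (a * rmap u)).
  have rM := @rel_mapM G Omega p H.
  elim/rel_factor_ind: u => [|u v IHu IHv|u IHu|w|i h] a.
  - by rewrite (group_morph1 rM) mulg1.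
  - by rewrite rM mulgA IHu IHv.
  - by rewrite (group_morphV rM) (IHu (a * _)) mulgVK.
  - by rewrite rel_map_free; apply: PEE; constructor 2; exists a, (val w).
  - rewrite rel_map_factor -(Pcs i a) -(Pcs i (a * val h)).
    by rewrite coset_eq//; exact/set_mem/(valP h).
have all a b : P (pt a) -> P (pt b).
  by have [u e] := ontoO (a^-1 * b); rewrite (step u a) e mulgA mulgV mul1g.
move=> x y; elim/coset_vertex_ind: x => [a|i a]; elim/coset_vertex_ind: y => [b|j b];
  by rewrite ?Pcs; exact: all.
Qed.

End CosetComplex.

Lemma relative_complex (G : groupType) (p : nat) (H : 'I_p -> subgroup G) :
  rel_finitely_presented H ->
  exists X : gcomplex G, (forall i, exists x : X, forall h, H i h -> cact h x = x) /\
    forall T : atree G, (forall i, exists t : T, forall h, H i h -> aact h t = t) ->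
      exists f : X -> T, forall g x, f (cact g x) = aact g (f x).
Proof.
move=> [Omega [finO ontoO [R finR kerR]]].
have [B [finB BV OB cob]] := coset_coboundary finO ontoO finR kerR.
exists (GComplex (singleton H 1) (@coset_act1 _ _ H) (@coset_actM _ _ H)
  (coset_adj_refl B) (coset_adj_sym BV) (coset_adj_act (B := B)) (coset_connected ontoO OB BV)
  cob (coset_adj_cofinite H finB) (coset_adj_free (B := B)) (coset_adj_finite_link finB)).
split; last exact: coset_equivariant_map.
by move=> i; exists (coset H i 1) => h; exact: coset_fixed.
Qed.

(** * JSJ trees *)

Lemma count_eq_sub (T : eqType) (a b : pred T) (s : seq T) :
  (forall x, a x -> b x) -> (count b s <= count a s)%N -> forall x, x \in s -> b x -> a x.
Proof.
move=> ab; elim: s => [//|y s IH] /=; have := sub_count ab s.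
case ay : (a y) => /=; first rewrite ab//= => le le' x.
  rewrite inE => /orP[/eqP ->//|]; exact: IH.
case by_ : (b y) => /= le le' x; first by lia.
rewrite inE => /orP[/eqP ->|]; [by rewrite by_|exact: IH].
Qed.

(** * Invariant subtrees *)

Section Subtree.
Variables (G : groupType) (T : atree G).
Implicit Types (Y Z : set T) (x y z : T).

Definition invariant_subtree Y := [/\ Y !=set0, connected_in (@aadj _ T) Y &
  forall g x, Y x -> Y (aact g x)].

(** Take an invariant subtree with the fewest elements in the finite set [B]. A smaller one meets
    [B] in the same elements, and every vertex can be translated into [B]. *)
Lemma minimal_invariant_subtree (B : set T) :
  finite_set B -> (forall x, exists g, B (aact g x)) ->
  exists2 Y, invariant_subtree Y & forall Z, invariant_subtree Z -> Z `<=` Y -> Z = Y.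
Proof.
move=> /finite_seqP[s ->] sP.
pose n Y := count (fun x => `[< Y x >]) s.
have P0 : exists k, `[< exists2 Y, invariant_subtree Y & n Y = k >].
  exists (n setT); apply/asboolP; exists setT => //; split=> //.
    exact: (tree_nonempty (atreeP T)).
  exact: (tree_connected (atreeP T)).
case: (ex_minnP P0) => k /asboolP[Y Yt nY] mink; exists Y => // Z Zt ZY.
rewrite eqEsubset; split=> // y Yy; have [g sgy] := sP y.
have [_ _ Zact] := Zt; have [_ _ Yact] := Yt.
suff Zgy : Z (aact g y) by rewrite -(aactK g y); exact: Zact.
apply/asboolP; apply: (count_eq_sub (a := fun x => `[< Z x >]) (b := fun x => `[< Y x >])) sgy _.
- by move=> x /asboolP Zx; apply/asboolP/ZY.
- by rewrite -/(n Y) -/(n Z) nY; apply: mink; apply/asboolP; exists Z.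
- by apply/asboolP/Yact.
Qed.

(** The last edge [wz] of the segment from [x] to [z] separates [x] from [y], so a path from [x] to
    [y] inside [Y] must use it. *)
Lemma subtree_convex Y x z y : connected_in (@aadj _ T) Y -> Y x -> Y y ->
  btw (atreeP T) x z y -> Y z.
Proof.
move=> Yc Yx Yy bz; case e : (dist (atreeP T) x z) => [|k]; first by rewrite -(dist_eq0 e).
have [w wz xw] := dist_pred e; have cs := side_cut (atreeP T) wz.
have [s [ps sy sY]] := Yc _ _ Yx Yy.
have bw : btw (atreeP T) x w z by rewrite /btw xw (adj_dist _ wz) e addn1.
have sx : side (atreeP T) w z x = false by rewrite /side e xw ltnNge leqnSn.
have sdy : side (atreeP T) w z y.
  rewrite /side (dist_sym _ y z) (dist_sym _ y w).
  by have := btw_trans bz bw; move: bz; rewrite /btw; lia.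
have : side (atreeP T) w z x <> side (atreeP T) w z (last x s) by rewrite sy sx sdy.
elim: s x Yx ps sY {bz e xw sy bw sx} => [//|a s IH] x Yx /= /andP[xa ps] sY ne.
have Ya : Y a by apply: sY; rewrite inE eqxx.
have sY' b : b \in s -> Y b by move=> bs; apply: sY; rewrite inE bs orbT.
have [eqs|/eqP nes] := eqVneq (side (atreeP T) w z x) (side (atreeP T) w z a).
  by apply: (IH a) => //; rewrite -eqs.
by case: (cs.2 _ _ xa nes) => -[ex ea]; subst.
Qed.

(** Take [y] in [Y] closest to [x]. A neighbour of [y] toward both [x] and [aact g y] would lie in
    [Y] by convexity and be closer; so [y] is between them and, the distances to [x] being equal,
    [aact g y = y]. *)
Lemma subtree_fixed_point Y (K : set G) x : invariant_subtree Y ->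
  (forall g, K g -> aact g x = x) -> exists2 y, Y y & forall g, K g -> aact g y = y.
Proof.
move=> [[y0 Yy0] Yc Yact] Kx.
have P0 : exists n, `[< exists2 y, Y y & dist (atreeP T) x y = n >].
  by exists (dist (atreeP T) x y0); apply/asboolP; exists y0.
case: (ex_minnP P0) => n /asboolP[y Yy xy] minn; exists y => // g Kg.
have Ygy := Yact g _ Yy.
have xgy : dist (atreeP T) x (aact g y) = n by rewrite -{1}(Kx _ Kg) dist_act.
case: (btw_or_neighbor (atreeP T) x y (aact g y)) => [b|[z [yz zx zg]]].
  by apply/esym/(@dist_eq0 _ _ (atreeP T)); move: b; rewrite /btw; lia.
have Yz : Y z.
  apply: (subtree_convex Yc Yy Ygy); rewrite /btw (adj_dist _ yz) zg; lia.
suff : (n <= dist (atreeP T) x z)%N.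
  by move: zx; rewrite (dist_sym _ y x) xy (dist_sym _ z x) => ->; rewrite ltnn.
by apply: minn; apply/asboolP; exists z.
Qed.

Section MinimalTree.
Variable Y : set T.
Hypotheses (Yt : invariant_subtree Y)
  (Ymin : forall Z, invariant_subtree Z -> Z `<=` Y -> Z = Y).

Notation V := {x : T | x \in Y}.
Let sadj : rel V := fun a b => aadj (val a) (val b).

Lemma subtree_act_subproof g (x : V) : aact g (val x) \in Y.
Proof. by have [_ _ Yact] := Yt; apply/mem_set/Yact/set_mem/(valP x). Qed.

Let sact g (a : V) : V := exist (fun b => b \in Y) _ (subtree_act_subproof g a).

Lemma subtree_walk (x y : V) : walk sadj x y.
Proof.
have [_ Yc _] := Yt; have [s [ps sy sY]] := Yc _ _ (set_mem (valP x)) (set_mem (valP y)).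
elim: s x ps sy sY => [x _ xy _|a s IH x /= /andP[xa ps] sy sY].
  have -> : x = y by exact: val_inj.
  exact: walk_refl.
have Ya : a \in Y by apply/mem_set/sY; rewrite inE eqxx.
apply: (walk_trans (walk_adj (y := exist (fun b => b \in Y) a Ya : V) xa)); apply: IH => // b bs.
by apply: sY; rewrite inE bs orbT.
Qed.

Lemma subtreeP : is_tree sadj.
Proof.
split.
- by have [[x Yx] _ _] := Yt; exists (exist (fun b => b \in Y) x (mem_set Yx)).
- by move=> x y; exact: (tree_adj_sym (atreeP T)).
- by move=> x; exact: (tree_adj_irr (atreeP T)).
- by apply: connected_of_walks => // x y _ _; exact: subtree_walk.
- move=> c /andP[cc uc]; rewrite -(size_map val).
  apply: (tree_acyclic (atreeP T)); rewrite /ucycle /ucycleb map_inj_uniq ?uc ?andbT//.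
  by rewrite cycle_map.
Qed.

Lemma subtree_act1 (a : V) : sact 1 a = a.
Proof. by apply: val_inj; exact: aact1. Qed.

Lemma subtree_actM g h (a : V) : sact (g * h) a = sact g (sact h a).
Proof. by apply: val_inj; exact: aactM. Qed.

Lemma subtree_act_adj g (a b : V) : sadj (sact g a) (sact g b) = sadj a b.
Proof. exact: aact_adj. Qed.

Lemma subtree_no_inversion g (a b : V) : sadj a b -> ~ (sact g a = b /\ sact g b = a).
Proof.
move=> xy [/(congr1 val) e1 /(congr1 val) e2]; exact: (ano_inversion (g := g) xy).
Qed.

Lemma subtree_minimal (Z : set V) : Z !=set0 -> connected_in sadj Z ->
  (forall g (a : V), Z a -> Z (sact g a)) -> Z = setT.
Proof.
move=> [z0 Zz0] Zc Zact.
have e : val @` Z = Y.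
  apply: Ymin; last by move=> _ [x _ <-]; exact/set_mem/(valP x).
  split; first by exists (val z0), z0.
    move=> _ _ [x Zx <-] [y Zy <-]; have [s [ps sy sZ]] := Zc _ _ Zx Zy.
    exists (map val s); split; first by rewrite path_map.
      by rewrite last_map sy.
    by move=> _ /mapP[z zs ->]; exists z => //; exact: sZ.
  by move=> g _ [x Zx <-]; exists (sact g x) => //; exact: Zact.
rewrite -subTset => a _; have [b Zb eb] : (val @` Z) (val a).
  by apply: (eq_ind_r (fun W : set T => W (val a)) _ e); exact/set_mem/(valP a).
by have -> : a = b by exact/esym/val_inj.
Qed.

Definition minimal_gtree : gtree G :=
  GTree subtreeP subtree_act1 subtree_actM subtree_act_adj subtree_no_inversion subtree_minimal.

End MinimalTree.

End Subtree.

Section JSJ.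
Variables (G : groupType) (A : set (subgroup G)) (p : nat) (H : 'I_p -> subgroup G).
Hypothesis subA : sub_closed A.

Definition universally_elliptic_subgroup (K : subgroup G) :=
  A K /\ forall T, AH_tree A H T -> elliptic T K.

(** Edge stabilizers are only asked to lie inside universally elliptic subgroups, a condition that
    passes directly to resolutions and blow-ups. *)
Definition ue_tree (T : atree G) :=
  (forall x y : T, aadj x y -> exists2 K, universally_elliptic_subgroup K & fixator x y `<=` K) /\
  (forall i, exists x : T, forall h, H i h -> aact h x = x).

Lemma ue_tree_of_gtree T : universally_elliptic A H T -> ue_tree (atree_of_gtree T).
Proof.
move=> [[AT HT] ueT]; split=> // x y xy; exists (edge_stab x y) => //.
by split; [exact: AT|move=> T' T'A; exact: ueT].
Qed.

Lemma unit_is_tree : is_tree (fun _ _ : unit => false).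
Proof.
apply: is_tree_of_cuts => //; first by exists tt.
by move=> [] []; exact: walk_refl.
Qed.

Definition unit_tree : atree G :=
  @ATree G unit _ (fun _ x => x) unit_is_tree (fun=> erefl) (fun _ _ _ => erefl)
    (fun _ _ _ => erefl) (fun _ _ _ (xy : false) _ => notF xy).

Lemma ue_unit_tree : ue_tree unit_tree.
Proof. by split=> // i; exists tt. Qed.

(** Each edge of the blow-up projects to an edge of [S] or of [T], whose stabilizer contains its
    own. *)
Lemma ue_blowup (S T : atree G) (q : S -> S -> T)
    (q_act : forall g s t, aadj s t -> q (aact g s) (aact g t) = aact g (q s t)) :
  ue_tree S -> ue_tree T -> ue_tree (blowup q_act).
Proof.
move=> [ueS HS] [ueT HT]; split.
  move=> [s t] [s' t'] /badjP[[/= _ /ueT[K uK subK]]|[/= /ueS[K uK subK] _ _]].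
    by exists K => // g [/(congr1 snd) e1 /(congr1 snd) e2]; apply: subK.
  by exists K => // g [/(congr1 fst) e1 /(congr1 fst) e2]; apply: subK.
move=> i; have [s sP] := HS i; have [t tP] := HT i; exists (s, t) => h Hh.
by congr pair; [exact: sP|exact: tP].
Qed.

Variable X : gcomplex G.
Hypothesis fixX : forall i, exists x : X, forall h, H i h -> cact h x = x.
Hypothesis mapX : forall T : atree G,
  (forall i, exists t : T, forall h, H i h -> aact h t = t) ->
  exists f : X -> T, forall g x, f (cact g x) = aact g (f x).

Lemma ue_resolution (T : atree G) (f : X -> T) (f_act : forall g x, f (cact g x) = aact g (f x)) :
  ue_tree T -> ue_tree (resolution f_act).
Proof.
move=> [ueT _]; split=> [c d /rproj_adj/ueT[K uK subK]|i].
  exists K => // g [gc gd]; apply: subK; split; [rewrite -{2}gc|rewrite -{2}gd];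
    by rewrite rproj_aact.
by have [x xP] := fixX i; exists (star f_act x) => h Hh; rewrite -star_act xP.
Qed.

(** * Length functions read on the edges of the complex *)

Section Lengths.
Variables (m : nat) (u v : 'I_m -> X).
Hypothesis (uvP : forall x y, cE x y -> exists k g, x = cact g (u k) /\ y = cact g (v k)).

Definition lengths (T : atree G) (f : X -> T) (D : T -> T -> rat) : 'rV[rat]_m :=
  (\row_k D (f (u k)) (f (v k)))%R.

Definition realizes (T : atree G) (f : X -> T) (l : 'rV[rat]_m) :=
  exists2 D, additive D & l = lengths f D.

Lemma realizes_span (T : atree G) (f : X -> T) (s : seq 'rV[rat]_m) l :
  (forall l', l' \in s -> realizes f l') -> l \in <<s>>%VS -> realizes f l.
Proof.
elim: s l => [|l0 s IH] l sP.
  rewrite span_nil memv0 => /eqP ->; exists (fun _ _ => 0%R); last first.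
    by apply/rowP => k; rewrite !mxE.
  by split=> // *; rewrite GRing.addr0.
rewrite span_cons => /memv_addP[_ /vlineP[k ->] [l2 /IH]].
case=> [l' l's|D2 aD2 e2]; first by apply: sP; rewrite inE l's orbT.
have [|D0 aD0 e0] := sP l0; first by rewrite inE eqxx.
move=> ->; exists (fun x y => D2 x y + k * D0 x y)%R; first exact: additive_comb.
by rewrite e2 e0; apply/rowP => i; rewrite !mxE GRing.addrC.
Qed.

Lemma lengths_inj (S T : atree G) (f : X -> S) (h : X -> T) D E :
  (forall g x, f (cact g x) = aact g (f x)) -> (forall g x, h (cact g x) = aact g (h x)) ->
  additive D -> additive E -> lengths f D = lengths h E ->
  forall x y, cE x y -> D (f x) (f y) = E (h x) (h y).
Proof.
move=> f_act h_act aD aE /rowP e x y /uvP[k [g [-> ->]]].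
by rewrite !f_act !h_act !additive_act//; have := e k; rewrite !mxE.
Qed.

(** The dimension of the space of realized length vectors is at least [r], witnessed by a free
    family. *)
Definition realizable_rank r := exists (T : atree G) (f : X -> T) (s : seq 'rV[rat]_m),
  [/\ ue_tree T, forall g x, f (cact g x) = aact g (f x), size s = r, free s &
    forall l, l \in s -> realizes f l].

Lemma realizable_rank0 : realizable_rank 0.
Proof.
exists unit_tree, (fun=> tt), [::]; split=> //; [exact: ue_unit_tree|exact: nil_free].
Qed.

Lemma realizable_rank_le r : realizable_rank r -> (r <= m)%N.
Proof.
move=> [T [f [s [_ _ <- /eqP <- _]]]].
by rewrite (leq_trans (dimvS (subvf _)))// dimvf /dim /= mul1n.
Qed.

(** For [s] of maximal size, a tree realizing [s] and a vector outside its span would give a free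
    family with one more element. *)
Lemma maximal_ue_tree : exists (T : atree G) (f : X -> T) (s : seq 'rV[rat]_m),
  [/\ ue_tree T, forall g x, f (cact g x) = aact g (f x), free s,
    forall l, l \in s -> realizes f l &
    forall (T' : atree G) (f' : X -> T') l, ue_tree T' -> (forall g x, f' (cact g x) = aact g (f' x)) ->
      (forall l', l' \in s -> realizes f' l') -> realizes f' l -> l \in <<s>>%VS].
Proof.
have P0 : exists r, `[< realizable_rank r >] by exists 0%N; exact/asboolP/realizable_rank0.
have Ple r : `[< realizable_rank r >] -> (r <= m)%N by move=> /asboolP/realizable_rank_le.
case: (ex_maxnP P0 Ple) => r /asboolP[T [f [s [ueT f_act sr frs sP]]]] maxr.
exists T, f, s; split=> // T' f' l ueT' f'_act s'P l'P; apply/negPn/negP => ls.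
have : (r.+1 <= r)%N; last by rewrite ltnn.
apply: maxr; apply/asboolP; exists T', f', (l :: s); split=> //=; first by rewrite sr.
  by rewrite free_cons ls.
by move=> l'; rewrite inE => /orP[/eqP ->//|/s'P].
Qed.

End Lengths.

Lemma finite_lower_bound (B : set rat) : finite_set B ->
  exists2 M : rat, (0 <= M)%R & forall b, B b -> (- M <= b)%R.
Proof.
move=> /finite_seqP[s ->]; elim: s => [|a s [M M0 MP]]; first by exists 0%R.
exists (M + `|a|)%R => [|b]; first by have := Num.Theory.normr_ge0 a; lra.
rewrite /= inE => /orP[/eqP ->|/MP].
  by have := Num.Theory.ler_norm (- a)%R; rewrite Num.Theory.normrN; lra.
by have := Num.Theory.normr_ge0 a; lra.
Qed.

Lemma ue_resolution_dominates : exists (T : atree G) (f : X -> T) (f_act : forall g x, f (cact g x) = aact g (f x)),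
  ue_tree T /\ forall T', universally_elliptic A H T' -> forall c : resolution f_act,
    exists t : T', forall g, aact g c = c -> act g t = t.
Proof.
have [m [u [v [cuv uvP]]]] := cE_cofinite X.
have [T [f [s [ueT f_act frs sP smax]]]] := maximal_ue_tree u v.
exists T, f, f_act; split=> // T0 ueT0; pose T' := atree_of_gtree T0.
have ueT' : ue_tree T' by exact: ue_tree_of_gtree.
pose S := resolution f_act; have ueS : ue_tree S by exact: ue_resolution.
have [t0 _] := tree_nonempty (atreeP T').
(* Attaching points for the blow-up: the stabilizer of an edge of [S] is contained in a universally
   elliptic subgroup, hence fixes a point of [T']. *)
have [||||||q0 q0P] := @equivariant_choice G (S * S)%type T'
  (fun g st => (aact g st.1, aact g st.2)) (@aact _ T') (fun st => aadj st.1 st.2) t0.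
- by move=> [a b]; rewrite !aact1.
- by move=> g h [a b]; rewrite !aactM.
- exact: aact1.
- exact: aactM.
- by move=> g [a b] ab; change (is_true (aadj (aact g (a : S)) (aact g (b : S)))); rewrite aact_adj.
- move=> [a b] /(ueS.1 a b)[K [_ /(_ _ ueT0.1)[t tP]] subK].
  by exists t => g [ga gb]; apply/tP/subK.
pose q (a b : S) := q0 (a, b).
have q_act g a b : aadj a b -> q (aact g a) (aact g b) = aact g (q a b) by exact: (q0P g (a, b)).
pose W := blowup q_act; have ueW : ue_tree W by exact: ue_blowup.
have [h h_act] := mapX ueT'.2.
pose fW x : W := (star f_act x, h x).
have fW_act g x : fW (cact g x) = aact g (fW x) by rewrite /fW star_act h_act.
have s_act := star_act f_act.
have sS l : l \in s -> realizes u v (star f_act) l.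
  move=> /sP[D aD ->]; have [D' aD' e] := additive_lift f_act aD.
  by exists D' => //; apply/rowP => k; rewrite !mxE e.
have sW l : l \in s -> realizes u v fW l.
  move=> /sS[D aD ->]; exists (fun c d : W => D c.1 d.1); first exact: additive_blowup.
  by apply/rowP => k; rewrite !mxE.
(* [W] realizes all of [s] through its projection to [S], so by maximality its distance lies in the
   span of [s] and is realized on [S] by some [D]. *)
have := smax W fW (lengths u v fW (fun c d => (dist (atreeP W) c d)%:R%R)) ueW fW_act sW.
case/(_ _)/(realizes_span sS) => [|D aD lD].
  by eexists; [exact: additive_dist|].
have dD := lengths_inj uvP fW_act s_act (additive_dist W) aD lD.
have [B finB BP] := resolution_cofinite f_act.
(* [D] may be negative on some edges, but takes finitely many values on edges, by cofiniteness. *)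
have [M M0 MP] : exists2 M : rat, (0 <= M)%R &
    forall b, [set D cd.1 cd.2 | cd in B `*` B] b -> (- M <= b)%R.
  by apply: finite_lower_bound; apply: finite_image; exact: finite_setX.
have DM (a b : S) : aadj a b -> (- M <= D a b)%R.
  move=> /radjP[x [y [a' [b' [ha [hb [_ -> ->]]]]]]]; have [g [Ba Bb]] := BP _ _ _ _ ha hb.
  apply: MP; exists (aact g (rpoint ha : S), aact g (rpoint hb : S)) => //=.
  by rewrite additive_act.
(* Adding [M] times the distance of [S] on both sides preserves the equality on the edges of [X],
   since the first component of [fW] is [star]. *)
have aE := additive_comb M (additive_dist W) (additive_blowup q_act (additive_dist S)).
have aC := additive_comb M aD (additive_dist S).
move=> c; have [||x y xy|[s0 t] tP] := resolution_vertex_elliptic fW_act aC _ aE _ _ c.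
- exact: additive_ge.
- move=> a b ab; have : (0 < (dist (atreeP W) a b)%:R :> rat)%R.
    by rewrite Num.Theory.ltr0n lt0n; apply/eqP => /dist_eq0.
  have := Num.Theory.mulr_ge0 M0 (Num.Theory.ler0n rat (dist (atreeP S) a.1 b.1)); lra.
- by rewrite dD.
by exists t => g /tP /(congr1 snd).
Qed.

(** The tree is a minimal invariant subtree of the resolution. Its vertex stabilizers are
    stabilizers of vertices of the resolution, hence fix points of every universally elliptic tree,
    and domination follows by equivariant choice. *)
Lemma JSJ_exists : exists2 T : gtree G, JSJ_tree A H T &
  forall x y : T, adj x y -> finitely_generated (edge_stab x y).
Proof.
have [T [f [f_act [ueT dom]]]] := ue_resolution_dominates.
pose S := resolution f_act; have ueS : ue_tree S by exact: ue_resolution.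
have [B finB BP] := resolution_cofinite f_act.
have [|Y Yt Ymin] := @minimal_invariant_subtree G S B finB.
  by elim/rvertex_ind=> x y w hw; have [g []] := BP _ _ _ _ hw hw; exists g.
exists (minimal_gtree Yt Ymin); last first.
  move=> x y xy; have -> : edge_stab x y = fixator (val x) (val y) :> set G.
    rewrite predeqE => g; split=> -[e1 e2].
      by split; [exact: (congr1 val e1)|exact: (congr1 val e2)].
    by split; exact: val_inj.
  move: x y xy => [c Yc] [d Yd] /= /radjP[x [y [a [b [ha [hb [ab -> ->]]]]]]].
  exact: fixator_finitely_generated.
have stabP (x y : minimal_gtree Yt Ymin) : adj x y -> exists2 K,
    universally_elliptic_subgroup K & edge_stab x y `<=` K.
  move=> /(ueS.1)[K uK subK]; exists K => // g [e1 e2]; apply: subK.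
  by split; [exact: (congr1 val e1)|exact: (congr1 val e2)].
split; first split; first split.
- by move=> x y /stabP[K [AK _] /subA]; exact.
- move=> i; have [s sP] := ueS.2 i.
  have [y Yy yP] := subtree_fixed_point Yt sP.
  by exists (exist _ y (mem_set Yy)) => g Hg; apply: val_inj; exact: yP.
- move=> T' AT' x y /stabP[K [_ /(_ _ AT')[t tP]] subK].
  by exists t => g /subK/tP.
move=> T' ueT'; have [t0 _] := tree_nonempty (gtreeP T').
have [||||||F FP] := @equivariant_choice G (minimal_gtree Yt Ymin) T' (@act _ _) (@act _ T')
  (fun=> True) t0; last by exists F => g x; exact: FP.
- exact: act1.
- exact: actM.
- exact: act1.
- exact: actM.
- by [].
move=> [c Yc] _; have [t tP] := dom _ ueT' c; exists t => g e.
by apply: tP; exact: (congr1 val e).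
Qed.

End JSJ.

Theorem theorem2p20 (G : groupType) (A : set (subgroup G))
    (p : nat) (H : 'I_p -> subgroup G) :
  finitely_generated [set: G] ->
  conj_closed A -> sub_closed A ->
  rel_finitely_presented H ->
  (exists T : gtree G, JSJ_deformation_space A H T) /\
  exists2 T : gtree G, JSJ_deformation_space A H T &
    forall x y : T, adj x y -> finitely_generated (edge_stab x y).
Proof.
move=> _ _ subA /relative_complex[X [fixX mapX]].
have [T JT fgT] := JSJ_exists subA fixX mapX.
by split; [exists T|exists T].
Qed.
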